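(* Let $0 < \theta_1 < p = p_1 = p_2 < \theta_2 < \infty$. Assume that $v_1, v_2 \in \mathcal{W}(\mathbb{R}^n)\cap C(\mathbb{R}^n)$, $\omega_1 \in {}^{\mathbf c}\Omega_{\theta_1}$ and $\omega_2 \in \Omega_{\theta_2}$. Then $$\|\mathrm{I}\|_{{}^{\mathbf c}LM_{p_1\theta_1,\omega_1}(\mathbb{R}^n,v_1)\to LM_{p_2\theta_2,\omega_2}(\mathbb{R}^n,v_2)} \approx \sup_{t\in(0,\infty)} \Big\| \|\omega_1\|_{\theta_1,(0,|\cdot|)}^{-1}\Big\|_{\infty,\,v_1^{-1}v_2,\,B(0,t)}\, \|\omega_2\|_{\theta_2,(t,\infty)}.$$
   Context: Let $n\ge 1$. For measurable $A$ (in $\mathbb{R}^n$ or $\mathbb{R}$), $\mathfrak{M}(A)$ is the set of measurable functions on $A$, $\mathfrak{M}^+(A)$ the non-negative ones, and $\mathcal{W}(A)$ the set of weights: measurable functions that are positive and finite a.e. on $A$. For $p\in(0,\infty]$, $\|f\|_{p,A}=(\int_A|f|^p)^{1/p}$ if $p<\infty$ and $\|f\|_{\infty,A}=\operatorname{ess\,sup}_A|f|$. For a non-negative measurable $w$, $\|f\|_{p,w,A}:=\|fw\|_{p,A}$ (the weight is inside the power). $C(\mathbb{R}^n)$ is the set of continuous functions on $\mathbb{R}^n$. $B(0,t)$ is the open ball of radius $t$ centred at $0$ and ${}^{\mathbf c}B(0,t)=\mathbb{R}^n\setminus B(0,t)$. For $0<p,\theta\le\infty$, $\omega\in\mathfrak{M}^+(0,\infty)$,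 $v\in\mathcal{W}(\mathbb{R}^n)$: - $LM_{p\theta,\omega}(\mathbb{R}^n,v)$ is the set of $f\in L^{\rm loc}_{p,v}(\mathbb{R}^n)$ (i.e. $\|f\|_{p,v,K}<\infty$ for compact $K$) with $\|f\|_{LM_{p\theta,\omega}(\mathbb{R}^n,v)}:=\big\|\,t\mapsto\|f\|_{p,v,B(0,t)}\big\|_{\theta,\omega,(0,\infty)}<\infty$; - ${}^{\mathbf c}LM_{p\theta,\omega}(\mathbb{R}^n,v)$ is the set of $f\in\bigcap_{t>0}L_{p,v}({}^{\mathbf c}B(0,t))$ (i.e. $\|f\|_{p,v,{}^{\mathbf c}B(0,t)}<\infty$ for all $t>0$) with $\|f\|_{{}^{\mathbf c}LM_{p\theta,\omega}(\mathbb{R}^n,v)}:=\big\|\,t\mapsto\|f\|_{p,v,{}^{\mathbf c}B(0,t)}\big\|_{\theta,\omega,(0,\infty)}<\infty$. $\Omega_\theta=\{\omega\in\mathfrak{M}^+(0,\infty):0<\|\omega\|_{\theta,(t,\infty)}<\infty\ \forall t>0\}$ and ${}^{\mathbf c}\Omega_\theta=\{\omega\in\mathfrak{M}^+(0,\infty):0<\|\omega\|_{\theta,(0,t)}<\infty\ \forall t>0\}$. $\|\mathrm{I}\|_{X\to Y}\in[0,\infty]$ is the least constant $c$ with $\|f\|_Y\le c\|f\|_X$ for all $f\in X$ ($\infty$ if there is none). $A\approx B$ means $\lambda^{-1}B\le A\le\lambda B$ with $\lambda\ge1$ depending only on inessential parameters, i.e. on $n$ and the exponents $p,\theta_i$,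 but not on the weights (in particular one side is infinite iff the other is). Conventions: $0/0=0$, $0\cdot(\pm\infty)=0$, $1/(\pm\infty)=0$. *)

(* Defs.v *)
From HB Require Import structures.
From mathcomp Require Import all_boot all_order all_algebra.
From mathcomp Require Import all_classical all_reals all_analysis.
From mathcomp Require Import measurable_realfun ess_sup_inf.

Set Implicit Arguments.
Unset Strict Implicit.
Unset Printing Implicit Defensive.

Import Order.TTheory GRing.Theory Num.Theory.
Import numFieldNormedType.Exports.

Local Open Scope classical_set_scope.
Local Open Scope ring_scope.
Local Open Scope ereal_scope.

(* The dimension is written n.+1, so that it is positive.  'rV[R]_n.+1 carries
   the product topology, but the library has no measure on it. *)
Section lebesgue_outer_measure.
Context {R : realType} {n : nat}.
Implicit Types (a b x : 'rV[R]_n.+1) (A : set 'rV[R]_n.+1).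

Definition box a b : set 'rV[R]_n.+1 :=
  [set x | forall i, (a 0 i < x 0 i <= b 0 i)%R].

Definition box_volume a b : R :=
  (\prod_(i < n.+1) Num.max 0 (b 0 i - a 0 i))%R.

Definition box_cover A : set (nat -> 'rV[R]_n.+1 * 'rV[R]_n.+1) :=
  [set c | A `<=` \bigcup_k box (c k).1 (c k).2].

Definition lebesgue_outer A : \bar R :=
  ereal_inf [set \sum_(k <oo) (box_volume (c k).1 (c k).2)%:E
            | c in box_cover A].

Let box_volume_ge0 a b : (0 <= box_volume a b)%R.
Proof. by apply: prodr_ge0 => i _; rewrite le_max lexx. Qed.

Let lebesgue_outer_ge0 A : 0 <= lebesgue_outer A.
Proof.
apply: le_ereal_inf_tmp => _ [c _ <-]; apply: nneseries_ge0 => k _ _.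
by rewrite lee_fin.
Qed.

Let le_lebesgue_outer : {homo lebesgue_outer : A B / A `<=` B >-> A <= B}.
Proof.
move=> A B AB; apply: ereal_inf_le_tmp => _ [c cB <-]; exists c => //.
exact: subset_trans AB cB.
Qed.

Let lebesgue_outer0 : lebesgue_outer set0 = 0.
Proof.
apply/eqP; rewrite eq_le lebesgue_outer_ge0 andbT.
apply: ereal_inf_lbound; exists (fun=> (0%R, 0%R)) => //.
apply: eseries0 => k _ _ /=.
by rewrite /box_volume big_ord_recl !mxE subrr maxxx mul0r.
Qed.

Let lebesgue_outer_sigma_subadditive : sigma_subadditive lebesgue_outer.
Proof.
move=> A; have [[i ioo]|] := pselect (exists i, lebesgue_outer (A i) = +oo).
  rewrite (eseries_pinfty _ _ ioo) ?leey// => k _.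
  by rewrite -ltNye (lt_le_trans _ (lebesgue_outer_ge0 _)).
rewrite -forallNE => Aoo.
apply/lee_addgt0Pr => e e0.
apply: (le_trans _ (epsilon_trick _ _ (ltW e0))) => //.
pose vol (c : 'rV[R]_n.+1 * 'rV[R]_n.+1) := (box_volume c.1 c.2)%:E.
have vol0 c : 0 <= vol c by rewrite lee_fin.
have /choice[G PG] : forall m, exists c, box_cover (A m) c /\
    \sum_(k <oo) vol (c k) <= lebesgue_outer (A m) + (e / (2 ^ m.+1)%:R)%:E.
  move=> m.
  have Afin : lebesgue_outer (A m) \is a fin_num.
    by rewrite ge0_fin_numE// ltey; exact/eqP/Aoo.
  have em : (0 < e / (2 ^ m.+1)%:R)%R by rewrite divr_gt0// ltr0n expn_gt0.
  have [_ [c Ac <-] cl] := lb_ereal_inf_adherent em Afin.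
  by exists c; split => //; exact: ltW.
have /card_esym/ppcard_eqP[f] := card_nat2.
apply: (@le_trans _ _ (\sum_(k <oo) vol (uncurry G (f k)))).
  apply: ereal_inf_lbound; exists (uncurry G \o f) => // t [m _ Amt].
  have [j _ Gt] := (PG m).1 _ Amt; exists (f^-1%FUN (m, j)) => //=.
  by rewrite invK ?inE.
have volG0 (ij : nat * nat) : 0 <= (vol \o uncurry G) ij by exact: vol0.
rewrite -(esum_pred_image (vol \o uncurry G) _ xpredT) ?[fun=> _]set_true//.
rewrite image_eq.
rewrite (_ : esum _ _ = \sum_(i <oo) \sum_(j <oo) vol (G i j)); last first.
  pose J : nat -> set (nat * nat) := fun i => [set (i, j) | j in setT].
  rewrite (_ : setT = \bigcup_k J k); last first.
    by rewrite predeqE => -[i j]; split => // _; exists i => //; exists j.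
  rewrite esum_bigcupT /=; last 2 first.
    - apply/trivIsetP => i j _ _ ij.
      rewrite predeqE => -[k m] /=; split => //= -[] [_] _ [<-{k} _].
      by move=> [m' _] [] /esym/eqP; rewrite (negbTE ij).
    - by [].
  rewrite -(image_id [set: nat]) -fun_true esum_pred_image//; last first.
    by move=> k _; exact: esum_ge0.
  apply: eq_eseriesr => /= j _.
  rewrite -(esum_pred_image (vol \o uncurry G) (pair j) predT)//=; last first.
    by move=> ? ? _ _; exact: (@can_inj _ _ _ snd).
  by congr esum; rewrite predeqE => -[k m]; split; move=> [i _ <-]; exists i.
apply: lee_nneseries => [k _ _|k _]; last exact: (PG k).2.
by apply: nneseries_ge0.
Qed.

HB.instance Definition _ := isOuterMeasure.Build R 'rV[R]_n.+1 lebesgue_outer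
  lebesgue_outer0 lebesgue_outer_ge0 le_lebesgue_outer
  lebesgue_outer_sigma_subadditive.

End lebesgue_outer_measure.

(* R^(n+1) with the Lebesgue (not only Borel) measurable sets *)
Definition lebRn (R : realType) (n : nat) : measurableType _ :=
  caratheodory_type (@lebesgue_outer R n).

Section lebesgue_Rn.
Context {R : realType} {n : nat}.

Definition lebesgue_Rn : set (lebRn R n) -> \bar R := @lebesgue_outer R n.

HB.instance Definition _ := isMeasure.Build _ _ _ lebesgue_Rn
  (@caratheodory_measure0 _ _ (@lebesgue_outer R n))
  (@caratheodory_measure_ge0 _ _ (@lebesgue_outer R n))
  (@caratheodory_measure_sigma_additive _ _ (@lebesgue_outer R n)).

End lebesgue_Rn.

(* R with the Lebesgue (not only Borel) measurable sets; this is the domain of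
   completed_lebesgue_measure *)
Definition lebR (R : realType) : measurableType _ :=
  caratheodory_type (wlength (@idfun R))^*%mu.

Definition itvR {R : realType} (i : interval R) : set (lebR R) := [set` i].

Section weighted_norms.
Context d {T : measurableType d} {R : realType}.
Variable mu : {measure set T -> \bar R}.
Implicit Types (p : \bar R) (A : set T) (f w : T -> \bar R).

(* f \_ A vanishes outside A *)
Definition normp p A f : \bar R := 'N[mu]_p[f \_ A].

Definition wnormp p w A f : \bar R := normp p A (fun x => f x * w x).

Definition nonneg_mfun A f : Prop :=
  measurable_fun A f /\ forall x, A x -> 0 <= f x.

Definition weight A w : Prop :=
  measurable_fun A w /\ {ae mu, forall x, A x -> 0 < w x < +oo}.

End weighted_norms.

Section Omega_classes.
Context {R : realType}.
Implicit Types (theta : \bar R) (omega : lebR R -> \bar R).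

Definition Omega theta omega : Prop :=
  nonneg_mfun (itvR `]0%R, +oo[) omega /\
  forall t : R, (0 < t)%R ->
    0 < normp completed_lebesgue_measure theta (itvR `]t, +oo[) omega < +oo.

Definition cOmega theta omega : Prop :=
  nonneg_mfun (itvR `]0%R, +oo[) omega /\
  forall t : R, (0 < t)%R ->
    0 < normp completed_lebesgue_measure theta (itvR `]0%R, t[) omega < +oo.

End Omega_classes.

Section local_Morrey_type_spaces.
Context {R : realType} {n : nat}.
Implicit Types (p theta : \bar R) (omega : lebR R -> \bar R).
Implicit Types (v f : lebRn R n -> \bar R).

(* the norm of the library on 'rV[R]_n.+1 is the sup norm *)
Definition euclidean_norm (x : 'rV[R]_n.+1) : R :=
  Num.sqrt (\sum_(i < n.+1) x 0 i ^+ 2)%R.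

Definition eball (t : R) : set (lebRn R n) :=
  [set x | (euclidean_norm x < t)%R].

Definition LM_norm p theta omega v f : \bar R :=
  wnormp completed_lebesgue_measure theta omega (itvR `]0%R, +oo[)
    (fun t => wnormp lebesgue_Rn p v (eball t) f).

Definition LM p theta omega v : set (lebRn R n -> \bar R) :=
  [set f | [/\ measurable_fun setT f,
    forall K : set 'rV[R]_n.+1, compact K -> wnormp lebesgue_Rn p v K f < +oo &
    LM_norm p theta omega v f < +oo]].

Definition cLM_norm p theta omega v f : \bar R :=
  wnormp completed_lebesgue_measure theta omega (itvR `]0%R, +oo[)
    (fun t => wnormp lebesgue_Rn p v (~` eball t) f).

Definition cLM p theta omega v : set (lebRn R n -> \bar R) :=
  [set f | [/\ measurable_fun setT f,
    forall t : R, (0 < t)%R -> wnormp lebesgue_Rn p v (~` eball t) f < +oo &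
    cLM_norm p theta omega v f < +oo]].

End local_Morrey_type_spaces.

(* +oo when no constant is admissible, in particular when X is not contained
   in Y *)
Definition embedding_norm {R : realType} {F : Type}
    (X : set F) (normX : F -> \bar R) (Y : set F) (normY : F -> \bar R) :
    \bar R :=
  ereal_inf [set c%:E | c in [set c : R | (0 <= c)%R /\
    forall f, X f -> Y f /\ normY f <= c%:E * normX f]].

(* Main.v *)
From HB Require Import structures.
Require Import Defs.
From mathcomp Require Import all_boot all_order all_algebra.
From mathcomp Require Import all_classical all_reals all_analysis.
From mathcomp Require Import measurable_realfun ess_sup_inf.
From mathcomp Require Import ring lra zify.

(* Write W1(r) and W2(r) for the norms of omega1 on (0, r) and of omega2 on
   (r, oo); the two sides are in fact equal.

   Upper bound.  If C is the supremum on the right, letting t decrease to |x|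
   gives v2(x) W2(|x|) <= C v1(x) W1(|x|) for almost every x.  Since p < theta2
   and theta1 < p, Minkowski's integral inequality, applied once in each
   direction, gives
     |f|_LM^p <= int (|f| v2 W2(|x|))^p  and
     int (|f| v1 W1(|x|))^p <= |f|_cLM^p.

   Lower bound.  If c is admissible, a > c and b > 0, then testing with
   f = 1_D / v1, where
     D = {|x| < t, W1(|x|) < b, a b v1(x) < v2(x) W2(t)},
   gives a b |D|^(1/p) <= |f|_LM <= c |f|_cLM <= c b |D|^(1/p), so D is null.
   Letting b run over the positive rationals, v2 W2(t) <= a v1 W1(|x|) almost
   everywhere in B(0, t). *)

Set Implicit Arguments.
Unset Strict Implicit.
Unset Printing Implicit Defensive.

Import Order.TTheory GRing.Theory Num.Theory.
Import numFieldNormedType.Exports.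

Local Open Scope classical_set_scope.
Local Open Scope ring_scope.
Local Open Scope ereal_scope.

(** * Monotonicity, powers and Hoelder's inequality for extended real functions *)

Section ge0_le_integral_nomeas.
Context d {T : measurableType d} {R : realType}.
Variable mu : {measure set T -> \bar R}.
Implicit Types (f g : T -> \bar R) (D : set T).

Import HBNNSimple.

(* Unlike [ge0_le_integral], no measurability: the integral of a nonnegative
   function is a supremum over the simple functions below it. *)
Lemma ge0_le_integral_nomeas D f g :
  (forall x, D x -> 0 <= f x) -> (forall x, D x -> f x <= g x) ->
  \int[mu]_(x in D) f x <= \int[mu]_(x in D) g x.
Proof.
move=> f0 fg; rewrite !(integral_mkcond D).
have f0' x : 0 <= (f \_ D) x by exact: erestrict_ge0.
have fg' x : (f \_ D) x <= (g \_ D) x by exact: lee_restrict.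
rewrite ge0_integralTE// ge0_integralTE; last first.
  by move=> x; exact: le_trans (fg' x).
by apply: ereal_sup_le => _ [h /= hf <-]; exists h => // x;
  exact: le_trans (fg' x).
Qed.

End ge0_le_integral_nomeas.

Section poweR_extra.
Context {R : realType}.
Implicit Types (x y : \bar R) (r : R).

Lemma ge0_le_poweR r x y : (0 <= r)%R -> 0 <= x -> x <= y -> x `^ r <= y `^ r.
Proof.
move=> r0 x0 xy; apply: gt0_ler_poweR => //; rewrite in_itv/= leey andbT//.
exact: le_trans xy.
Qed.

Lemma poweRK r x : r != 0%R -> 0 <= x -> (x `^ r) `^ r^-1 = x.
Proof. by move=> r0 x0; rewrite -poweRrM mulfV// poweRe1. Qed.

Lemma poweRVK r x : r != 0%R -> 0 <= x -> (x `^ r^-1) `^ r = x.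
Proof. by move=> r0 x0; rewrite -poweRrM mulVf// poweRe1. Qed.

End poweR_extra.

Lemma measurable_poweR_abse d (T : measurableType d) (R : realType) (D : set T)
    (f : T -> \bar R) (r : R) :
  measurable_fun D f -> measurable_fun D (fun x => `|f x| `^ r).
Proof.
move=> mf; apply: (@measurableT_comp _ _ _ _ _ _ (fun x => x `^ r)) => //.
  exact: measurable_poweR.
exact: measurableT_comp.
Qed.

Section hoelder_ereal.
Context d {T : measurableType d} {R : realType}.
Variable mu : {measure set T -> \bar R}.

(** An infinite norm of [f] makes the bound trivial, because the norm of [g] is positive and the
    product is then [+oo] rather than [0]. Otherwise [f] is finite almost everywhere, and replacing
    it by [fine \o f] reduces to the inequality for real functions. *)
Lemma hoelder_EFinr (f : T -> \bar R) (g : T -> R) (p q : R) :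
  measurable_fun setT f -> measurable_fun setT g ->
  (0 < p)%R -> (0 < q)%R -> (p^-1 + q^-1 = 1)%R ->
  0 < 'N[mu]_q%:E[EFin \o g] ->
  \int[mu]_x `|f x * (g x)%:E| <= 'N[mu]_p%:E[f] * 'N[mu]_q%:E[EFin \o g].
Proof.
move=> mf mg p0 q0 pq g0.
have [->|foo] := eqVneq 'N[mu]_p%:E[f] +oo; first by rewrite gt0_mulye// leey.
have pn0 : p != 0%R by rewrite gt_eqF.
have mfp : measurable_fun setT (fun x => `|f x| `^ p).
  exact: measurable_poweR_abse.
have ifp : mu.-integrable setT (fun x => `|f x| `^ p).
  apply/integrableP; split => //.
  under eq_integral do rewrite gee0_abs ?poweR_ge0//.
  by rewrite -poweR_Lnorm// poweR_lty// ltey.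
have ffin : {ae mu, forall x, f x = (fine (f x))%:E}.
  apply: filterS (integrable_ae measurableT ifp) => x /(_ I).
  by case: (f x) => [//||] /=; rewrite (negbTE pn0).
have mff : measurable_fun setT (fine \o f) by exact: measurableT_comp.
have mEff : measurable_fun setT (EFin \o (fine \o f)) by exact/measurable_EFinP.
have -> : 'N[mu]_p%:E[f] = 'N[mu]_p%:E[EFin \o (fine \o f)].
  rewrite unlock; congr (_ `^ _); apply: ae_eq_integral => //.
    exact: measurable_poweR_abse.
  by apply: filterS ffin => x {1}-> _.
apply: le_trans (hoelder _ mff mg p0 q0 pq); rewrite Lnorm1.
rewrite (ae_eq_integral (fun x => `|(fine (f x) * g x)%:E|))//.
- apply: measurableT_comp => //; apply: emeasurable_funM => //.
  exact/measurable_EFinP.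
- apply: measurableT_comp => //; apply/measurable_EFinP.
  exact: measurable_funM.
- by apply: filterS ffin => x {1}-> _.
Qed.

End hoelder_ereal.

(** * Minkowski's integral inequality *)

Section minkowski_integral.
Context d1 d2 {T1 : measurableType d1} {T2 : measurableType d2} {R : realType}.
Variable m1 : {sigma_finite_measure set T1 -> \bar R}.
Variable m2 : {sigma_finite_measure set T2 -> \bar R}.
Variables (k : T1 * T2 -> \bar R) (q : R).
Hypothesis mk : measurable_fun setT k.
Hypothesis k0 : forall z, 0 <= k z.
Hypothesis q1 : (1 < q)%R.

Let F y := \int[m1]_x k (x, y).

Let q0 : (0 < q)%R. Proof. exact: lt_trans q1. Qed.

Let mF : measurable_fun setT F.
Proof. exact: measurable_fun_fubini_tonelli_G. Qed.

Let F0 y : 0 <= F y. Proof. exact: integral_ge0. Qed.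

(* The truncation makes the [q]-th moment of [g] finite, so that it can be
   divided out after Hoelder's inequality. *)
Let truncated (g : T2 -> R) : measurable_fun setT g ->
  (forall y, 0 <= g y)%R -> (forall y, (g y)%:E <= F y) ->
  \int[m2]_y (g y `^ q)%:E < +oo ->
  (\int[m2]_y (g y `^ q)%:E) `^ q^-1
    <= \int[m1]_x (\int[m2]_y k (x, y) `^ q) `^ q^-1.
Proof.
move=> mg g0 gF; set I := \int[m2]_y _ => Ioo.
set S := \int[m1]_x _.
have qn0 : q != 0%R by rewrite gt_eqF.
have I0 : 0 <= I by apply: integral_ge0 => y _; rewrite lee_fin powR_ge0.
have S0 : 0 <= S by apply: integral_ge0 => y _; rewrite poweR_ge0.
(* Hoelder's inequality and the final cancellation both need a positive moment. *)
have [->|In0] := eqVneq I 0; first by rewrite poweR0r ?invr_eq0.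
have Igt0 : 0 < I by rewrite lt0e In0.
have mgq : measurable_fun setT (fun y => g y `^ (q - 1))%R.
  by apply: (@measurableT_comp _ _ _ _ _ _ (@powR R ^~ (q - 1))%R).
(* The exponent conjugate to [q]: since [(q - 1) * q' = q], the [q']-norm of [g ^ (q - 1)] is a
   power of [I]. *)
pose q' := (q / (q - 1))%R.
have qB1 : (0 < q - 1)%R by rewrite subr_gt0.
have q'0 : (0 < q')%R by rewrite divr_gt0.
have Nq' : 'N[m2]_q'%:E[EFin \o (fun y => g y `^ (q - 1))%R] = I `^ q'^-1.
  rewrite unlock; congr (_ `^ _); apply: eq_integral => y _ /=.
  rewrite ger0_norm ?powR_ge0// -powRrM; congr ((_ `^ _)%:E).
  by rewrite /q' mulrCA divff ?mulr1// gt_eqF.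
(* Write [g ^ q] as [g * g ^ (q - 1)], bound the first factor by [F], exchange the integrals by
   Tonelli, and apply Hoelder in [y] for each fixed [x]. *)
have Ile : I <= S * I `^ q'^-1.
  have : I <= \int[m2]_y \int[m1]_x (k (x, y) * (g y `^ (q - 1))%:E).
    apply: ge0_le_integral_nomeas => [y _|y _].
      by rewrite lee_fin powR_ge0.
    rewrite ge0_integralZr//; last 2 first.
      - exact: measurableT_comp.
      - by rewrite lee_fin powR_ge0.
    by rewrite -mulr_powRB1// EFinM lee_wpmul2r// lee_fin powR_ge0.
  move/le_trans; apply.
  rewrite -(@fubini_tonelli _ _ _ _ _ m1 m2
    (fun z => k z * (g z.2 `^ (q - 1))%:E)); last 2 first.
  - apply: emeasurable_funM => //; apply/measurable_EFinP.
    exact: (measurableT_comp mgq).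
  - by move=> z; rewrite mule_ge0// lee_fin powR_ge0.
  rewrite -ge0_integralZr//; last 3 first.
  - apply: (measurableT_comp (measurable_poweR _)).
    apply: (measurable_fun_fubini_tonelli_F (fun z => k z `^ q)) => [|z].
      exact: (measurableT_comp (measurable_poweR _)).
    exact: poweR_ge0.
  - by move=> *; exact: poweR_ge0.
  - exact: poweR_ge0.
  apply: ge0_le_integral_nomeas => [x _|x _].
    by apply: integral_ge0 => y _; rewrite mule_ge0// lee_fin powR_ge0.
  have mkx : measurable_fun setT (fun y => k (x, y)) by exact: measurableT_comp.
  have qq' : (q^-1 + q'^-1 = 1)%R.
    by rewrite /q' invf_div mulrBl divff// mul1r addrC subrK.
  have := @hoelder_EFinr _ _ _ m2 _ _ _ _ mkx mgq q0 q'0 qq'.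
  rewrite Nq' unlock => /(_ (poweR_gt0 _ Igt0)).
  under eq_integral do rewrite gee0_abs ?mule_ge0// ?lee_fin ?powR_ge0//.
  by under [X in _ <= X `^ _ * _ -> _]eq_integral do rewrite gee0_abs//.
(* Splitting [I] according to [1 = 1/q + 1/q'] lets the positive finite factor [I ^ (1/q')] be
   cancelled. *)
have Ipow : I = I `^ q^-1 * I `^ q'^-1.
  rewrite -poweRD.
    by rewrite /q' invf_div mulrBl divff// mul1r addrC subrK poweRe1.
  by rewrite nneg_neq0_poweRD_def// invr_ge0 ltW.
rewrite -(@lee_pmul2r _ (I `^ q'^-1)) -?Ipow ?poweR_gt0//.
by rewrite fin_num_poweR// ge0_fin_numE.
Qed.

(** The truncations [min(F, n)] on sets [B n] of finite measure exhausting the space have finite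
    moments and increase to [F], so the truncated inequality passes to the limit by monotone
    convergence. *)
Lemma minkowski_integral :
  (\int[m2]_y (\int[m1]_x k (x, y)) `^ q) `^ q^-1
    <= \int[m1]_x (\int[m2]_y k (x, y) `^ q) `^ q^-1.
Proof.
have qn0 : q != 0%R by rewrite gt_eqF.
have /sigma_finiteP[B [BT ndB mBfin]] := sigma_finiteT m2.
pose g n y : R := (fine (mine (F y) n%:R%:E) * \1_(B n) y)%R.
have minE n y : (fine (mine (F y) n%:R%:E))%:E = mine (F y) n%:R%:E.
  rewrite fineK// ge0_fin_numE; last by rewrite le_min F0 lee_fin ler0n.
  by rewrite (@le_lt_trans _ _ n%:R%:E) ?ltry// ge_min lexx orbT.
have min_ge0 n y : (0 <= fine (mine (F y) n%:R%:E))%R.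
  by rewrite -lee_fin minE le_min F0 lee_fin/=.
have g0 n y : (0 <= g n y)%R by rewrite mulr_ge0.
have gF n y : (g n y)%:E <= F y.
  rewrite (@le_trans _ _ (mine (F y) n%:R%:E)) ?ge_min ?lexx//.
  rewrite -minE lee_fin ler_piMr// indicE; by case: (_ \in _).
have g_le n y : (g n y <= n%:R * \1_(B n) y)%R.
  by rewrite ler_wpM2r// -lee_fin minE ge_min lexx orbT.
have mg n : measurable_fun setT (g n).
  apply: measurable_funM; last first.
    by apply: measurable_indic; exact: (mBfin n).1.
  apply: measurableT_comp => //; exact: measurable_mine.
have gqfin n : \int[m2]_y (g n y `^ q)%:E < +oo.
  apply: (@le_lt_trans _ _ (\int[m2]_y ((n%:R `^ q)%:E * (\1_(B n) y)%:E))).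
    apply: ge0_le_integral_nomeas => y _; first by rewrite lee_fin powR_ge0.
    have := g_le n y; rewrite indicE -EFinM lee_fin; case: (y \in B n).
      by rewrite !mulr1 => gny; rewrite ge0_ler_powR ?nnegrE ?(ltW q0).
    rewrite !mulr0 => gny; have -> : g n y = 0%R.
      by apply/eqP; rewrite eq_le g0 andbT.
    by rewrite powR0.
  have [mB Boo] := mBfin n.
  rewrite ge0_integralZl_EFin ?powR_ge0//; last first.
    by apply/measurable_EFinP; exact: measurable_indic.
  by rewrite integral_indic// setIT lte_mul_pinfty// lee_fin powR_ge0.
have nd_g y : {homo (fun n => (g n y `^ q)%:E) : m n / (m <= n)%N >-> m <= n}.
  move=> m n mn; rewrite lee_fin ge0_ler_powR ?nnegrE ?(ltW q0)//.
  apply: ler_pM => //.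
    rewrite -lee_fin !minE le_min ge_min lexx/=.
    by rewrite ge_min lee_fin ler_nat mn orbT.
  rewrite !indicE ler_nat; case: (boolP (y \in B m)) => // yB.
  suff -> : y \in B n by [].
  by move: yB; rewrite !inE; apply/subsetPset/ndB.
(* Once [y] is in [B n] only the minimum with [n] matters: the sequence is eventually constant if
   [F y] is finite, and equals [n ^ q >= n] if it is infinite. *)
have cvg_g y : (g n y `^ q)%:E @[n --> \oo] --> F y `^ q.
  have [i _ Biy] : (\bigcup_i B i) y by rewrite -BT.
  have gE n : (i <= n)%N -> (g n y)%:E = mine (F y) n%:R%:E.
    move=> ni; have yB : y \in B n.
      by rewrite inE; move: y Biy; exact/subsetPset/ndB.
    by rewrite /g indicE yB mulr1 minE.
  case Fy : (F y) => [r||]; last by have := F0 y; rewrite Fy.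
    apply: cvg_near_cst; near=> n.
    rewrite -poweR_EFin gE; last by near: n; exact: nbhs_infty_ge.
    rewrite Fy min_l// lee_fin; near: n; exact: nbhs_infty_ger.
  rewrite poweRyr//; apply/cvgeyPge => A; near=> n.
  rewrite -poweR_EFin gE; last by near: n; exact: nbhs_infty_ge.
  rewrite Fy minye.
  have n1 : (1 <= n%:R :> R)%R by near: n; exact: nbhs_infty_ger.
  apply: (@le_trans _ _ n%:R%:E).
    by rewrite lee_fin; near: n; exact: nbhs_infty_ger.
  by rewrite poweR_EFin lee_fin -[leLHS]powRr1// ler_powR// ltW.
set S := \int[m1]_x _.
have S0 : 0 <= S by apply: integral_ge0 => y _; rewrite poweR_ge0.
suff : \int[m2]_y (F y `^ q) <= S `^ q.
  move/(@ge0_le_poweR _ q^-1); rewrite poweRK//; apply.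
    by rewrite invr_ge0 ltW.
  by apply: integral_ge0 => y _; rewrite poweR_ge0.
have -> : \int[m2]_y (F y `^ q) = \int[m2]_y limn (fun n => (g n y `^ q)%:E).
  by apply: eq_integral => y _; apply/esym/cvg_lim.
have mgq n : measurable_fun setT (fun y => (g n y `^ q)%:E).
  apply/measurable_EFinP.
  by apply: (@measurableT_comp _ _ _ _ _ _ (@powR R ^~ q)).
rewrite monotone_convergence//; last by move=> n y _; rewrite lee_fin powR_ge0.
apply: lime_le.
  apply: ereal_nondecreasing_is_cvgn => m n mn.
  apply: ge0_le_integral_nomeas => y _.
    by rewrite lee_fin powR_ge0.
  exact: nd_g.
apply: nearW => n.
rewrite -(@poweRVK _ q (\int[m2]_y _))//; last first.
  by apply: integral_ge0 => y _; rewrite lee_fin powR_ge0.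
apply: ge0_le_poweR; [exact: ltW|exact: poweR_ge0|exact: truncated].
Unshelve. all: by end_near. Qed.

End minkowski_integral.

(** * Lebesgue measure on R^n: measurable balls and sigma-finiteness *)

Section lebesgue_Rn_measurability.
Context {R : realType} {n : nat}.
Implicit Types (a b x : 'rV[R]_n.+1) (i : 'I_n.+1) (r t : R).

Lemma box_volume_ge0 a b : (0 <= box_volume a b)%R.
Proof. by apply: prodr_ge0 => i _; rewrite le_max lexx. Qed.

(** With [cut_bot] below: the hyperplane [x_i = r] splits the box from [a] to [b] into the box from
    [a] to [cut_top i r b] and the box from [cut_bot i r a] to [b]; one of them is empty if the
    hyperplane misses the box. *)
Definition cut_top i r b : 'rV[R]_n.+1 :=
  (\row_j if j == i then Num.min (b 0 j) r else b 0 j)%R.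

Definition cut_bot i r a : 'rV[R]_n.+1 :=
  (\row_j if j == i then Num.max (a 0 j) r else a 0 j)%R.

Lemma box_volume_split i r a b :
  (box_volume a (cut_top i r b) + box_volume (cut_bot i r a) b
    = box_volume a b)%R.
Proof.
rewrite /box_volume (bigD1 i)//= [X in (_ + X)%R](bigD1 i)//=.
rewrite [RHS](bigD1 i)//= !mxE eqxx.
under eq_bigr => j /negbTE ji do rewrite mxE ji.
under [X in (_ + _ * X)%R]eq_bigr => j /negbTE ji do rewrite mxE ji.
rewrite -mulrDl; congr (_ * _)%R.
rewrite /Num.min /Num.max; repeat case: ifPn; lra.
Qed.

(** Cutting each box of a cover of [X] along the hyperplane gives covers of the two parts of [X]
    with the same total volume, which is Caratheodory's criterion. *)
Lemma caratheodory_halfspace i r :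
  (@lebesgue_outer R n).-caratheodory [set x | (x 0 i <= r)%R].
Proof.
apply: le_caratheodory_measurable => X.
apply: le_ereal_inf_tmp => _ [c cX <-].
pose c1 k := ((c k).1, cut_top i r (c k).2).
pose c2 k := (cut_bot i r (c k).1, (c k).2).
apply: (@le_trans _ _ (\sum_(k <oo) (box_volume (c1 k).1 (c1 k).2)%:E +
                       \sum_(k <oo) (box_volume (c2 k).1 (c2 k).2)%:E)).
  apply: leeD; apply: ereal_inf_lbound.
    exists c1 => // x [Xx /= xr]; have [k _ ckx] := cX _ Xx.
    exists k => // j /=; rewrite mxE; have /andP[-> xb] := ckx j.
    by case: eqP => [ji|//]; rewrite le_min xb ji.
  exists c2 => // x [Xx /= /negP]; rewrite -ltNge => xr.
  have [k _ ckx] := cX _ Xx.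
  exists k => // j /=; rewrite mxE; have /andP[ax ->] := ckx j.
  by case: eqP => [ji|_]; rewrite ?gt_max ax ?ji ?xr.
rewrite -nneseriesD => [|k _ _|k _ _]; last 2 first.
- by rewrite lee_fin box_volume_ge0.
- by rewrite lee_fin box_volume_ge0.
apply: lee_nneseries => k _; first by rewrite adde_ge0// lee_fin box_volume_ge0.
by rewrite -EFinD box_volume_split.
Qed.

Lemma measurable_coord i :
  measurable_fun setT (fun x : lebRn R n => (x : 'rV[R]_n.+1) 0%R i).
Proof.
apply: (measurability (@RGenOInfty.G R)) => [|_ [_ [r ->] <-]].
  exact: RGenOInfty.measurableE.
rewrite setTI [X in measurable X](_ : _ =
    ~` [set x : lebRn R n | (x 0%R i <= r)%R]).
  by apply: measurableC; exact: caratheodory_halfspace.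
by apply/seteqP; split => x /=; rewrite in_itv/= andbT ltNge => /negP.
Qed.

Lemma measurable_euclidean_norm :
  measurable_fun setT (@euclidean_norm R n : lebRn R n -> R).
Proof.
apply: (@measurableT_comp _ _ _ _ _ _ (@Num.sqrt R)).
  apply: continuous_measurable_fun; exact: sqrt_continuous.
apply: measurable_sum => i; apply: measurable_funX; exact: measurable_coord.
Qed.

Lemma measurable_eball t : measurable (@eball R n t).
Proof.
rewrite (_ : eball t = @euclidean_norm R n @^-1` `]-oo, t[); last first.
  by apply/seteqP; split => x /=; rewrite in_itv.
by rewrite -[X in measurable X]setTI; exact: measurable_euclidean_norm.
Qed.

Lemma euclidean_norm_ge0 x : (0 <= euclidean_norm x)%R.
Proof. exact: sqrtr_ge0. Qed.

Lemma abs_coord_le_euclidean_norm x i : (`|x 0 i| <= euclidean_norm x)%R.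
Proof.
rewrite -sqrtr_sqr ler_sqrt; last by apply: sumr_ge0 => j _; exact: sqr_ge0.
rewrite (bigD1 i)//= lerDl; apply: sumr_ge0 => j _; exact: sqr_ge0.
Qed.

Lemma lebesgue_Rn_eball_lty t : lebesgue_Rn (@eball R n t) < +oo.
Proof.
(* One cube contains the ball; the remaining boxes are degenerate and add no volume. *)
pose c k : 'rV[R]_n.+1 * 'rV[R]_n.+1 :=
  if k is 0%N then (const_mx (- `|t| - 1)%R, const_mx `|t|%R) else (0%R, 0%R).
apply: (@le_lt_trans _ _ (\sum_(k <oo) (box_volume (c k).1 (c k).2)%:E)).
  apply: ereal_inf_lbound; exists c => // x /= xt; exists 0%N => // i /=.
  rewrite !mxE; have := abs_coord_le_euclidean_norm x i.
  by move: xt; rewrite /eball/= ler_norml; have := ler_norm t; lra.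
rewrite (nneseries_split _ 1)//.
  rewrite big_nat1 eseries0 ?adde0 ?ltry// => -[//|k] _ _ /=.
  by rewrite /box_volume big_ord_recl !mxE subrr maxxx mul0r.
by move=> k _; rewrite lee_fin box_volume_ge0.
Qed.

Lemma compact_sub_eball (K : set 'rV[R]_n.+1) : compact K ->
  exists2 t, (0 < t)%R & K `<=` @eball R n t.
Proof.
move=> /compact_bounded [M [Mreal KM]].
pose b := (`|M| + 1)%R.
have b0 : (0 < b)%R by rewrite ltr_wpDl.
have Kb x : K x -> (`|x| <= b)%R.
  by apply: KM; rewrite /b (le_lt_trans (ler_norm _))// ltrDl.
(* [b] bounds the sup norm, so the Euclidean norm is at most [b] times the square root of [n.+1],
   hence below [b * n.+2]. *)
exists (b * n.+2%:R)%R; first by rewrite mulr_gt0.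
move=> x Kx; rewrite /eball/=.
have bn0 : (0 < b * n.+2%:R)%R by rewrite mulr_gt0.
rewrite -[ltRHS]ger0_norm ?(ltW bn0)// -sqrtr_sqr /euclidean_norm.
rewrite ltr_sqrt ?exprn_gt0//.
have xib i : (x 0%R i ^+ 2 <= b ^+ 2)%R.
  rewrite -[leLHS]real_normK ?num_real// lerXn2r ?nnegrE ?(ltW b0)//.
  apply: le_trans (Kb _ Kx); rewrite [leRHS]/Num.Def.normr /= mx_normrE.
  by apply/bigmax_geP; right => /=; exists (0%R, i).
apply: (@le_lt_trans _ _ (\sum_(i < n.+1) b ^+ 2)%R); first exact: ler_sum.
rewrite sumr_const card_ord exprMn -[ltLHS]mulr_natr ltr_pM2l ?exprn_gt0//.
by rewrite -natrX ltr_nat -mulnn; nia.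
Qed.

End lebesgue_Rn_measurability.

Section lebesgue_Rn_sigma_finite.
Context {R : realType} {n : nat}.

Let lebesgue_Rn_sigma_finite : sigma_finite setT (@lebesgue_Rn R n).
Proof.
exists (fun k => eball k%:R) => [|k].
  apply/seteqP; split => // x _.
  exists (Num.truncn (euclidean_norm x)).+1 => //.
  exact: truncnS_gt.
split; [exact: measurable_eball|exact: lebesgue_Rn_eball_lty].
Qed.

HB.instance Definition _ := Measure_isSigmaFinite.Build _ _ _
  (@lebesgue_Rn R n) lebesgue_Rn_sigma_finite.

End lebesgue_Rn_sigma_finite.

(** * Measurability on the line, and L^p norms over sets *)

Section lebR_measurability.
Context {R : realType}.

Lemma itvRE (i : interval R) (t : R) : itvR i t = (t \in i).
Proof. by []. Qed.

Lemma mem_itvR (i : interval R) (t : R) : (t \in itvR i) = (t \in i).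
Proof. by apply/idP/idP => [/set_mem//|ti]; exact/mem_set. Qed.

Lemma measurable_itvR (i : interval R) : measurable (itvR i).
Proof. by apply: sub_caratheodory; exact: measurable_itv. Qed.

Lemma measurable_lebR_id : measurable_fun setT (id : lebR R -> R).
Proof.
move=> _ B mB; rewrite setTI; exact: sub_caratheodory.
Qed.

Lemma completed_lebesgue_measure_set1 (r : R) :
  completed_lebesgue_measure ([set r] : set (lebR R)) = 0.
Proof. exact: lebesgue_measure_set1. Qed.

(** The weights are assumed measurable on (0, oo) only; extension by zero turns them into factors on
    the whole line for Minkowski's inequality. *)
Lemma measurable_restrict_pos (f : lebR R -> \bar R) :
  measurable_fun (itvR `]0%R, +oo[) f ->
  measurable_fun setT (f \_ (itvR (`]0%R, +oo[ : interval R))).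
Proof.
by move=> mf; apply/(measurable_restrictT _ _).1 => //; exact: measurable_itvR.
Qed.

End lebR_measurability.

Section normp_theory.
Context d {T : measurableType d} {R : realType}.
Variable mu : {measure set T -> \bar R}.
Variable p : R.
Hypothesis p0 : (0 < p)%R.
Implicit Types (A B : set T) (f g : T -> \bar R).

Let pn0 : p != 0%R. Proof. by rewrite gt_eqF. Qed.

Lemma normp_ge0 (q : \bar R) A f : 0 <= normp mu q A f.
Proof. exact: Lnorm_ge0. Qed.

Lemma normpE A f :
  normp mu p%:E A f = (\int[mu]_(x in A) `|f x| `^ p) `^ p^-1.
Proof.
rewrite /normp unlock [in RHS]integral_mkcond; congr (_ `^ _).
apply: eq_integral => x _; rewrite !patchE; case: ifPn => // _.
by rewrite abse0 poweR0r.
Qed.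

Lemma poweR_normp A f :
  normp mu p%:E A f `^ p = \int[mu]_(x in A) `|f x| `^ p.
Proof.
rewrite normpE poweRVK//.
by apply: integral_ge0 => x _; exact: poweR_ge0.
Qed.

Lemma le_normp A f g : (forall x, A x -> `|f x| <= `|g x|) ->
  normp mu p%:E A f <= normp mu p%:E A g.
Proof.
move=> fg; rewrite !normpE ge0_le_poweR ?invr_ge0 ?(ltW p0)//.
  by apply: integral_ge0 => x _; exact: poweR_ge0.
apply: ge0_le_integral_nomeas => x Ax; first exact: poweR_ge0.
by rewrite ge0_le_poweR ?(ltW p0)// fg.
Qed.

Lemma normp_restrict A B f :
  normp mu p%:E A (f \_ B) = normp mu p%:E (A `&` B) f.
Proof. by rewrite /normp patch_setI. Qed.

Lemma normp_subset A B f : A `<=` B ->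
  normp mu p%:E A f <= normp mu p%:E B f.
Proof.
move=> AB; rewrite /normp !unlock ge0_le_poweR ?invr_ge0 ?(ltW p0)//.
  by apply: integral_ge0 => x _; exact: poweR_ge0.
apply: ge0_le_integral_nomeas => x _; first exact: poweR_ge0.
rewrite ge0_le_poweR ?(ltW p0)// !patchE; case: ifPn => xA.
  by rewrite ifT//; move: xA; rewrite !inE; exact: AB.
by rewrite abse0 abse_ge0.
Qed.

Lemma normpZl A (c : \bar R) f : measurable A -> measurable_fun A f -> 0 <= c ->
  normp mu p%:E A (fun x => c * f x) = c * normp mu p%:E A f.
Proof.
move=> mA mf c0; rewrite !normpE.
under eq_integral do rewrite abseM gee0_abs// poweRM//.
rewrite ge0_integralZl//; last 3 first.
- exact: measurable_poweR_abse.
- by move=> x _; exact: poweR_ge0.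
- exact: poweR_ge0.
rewrite poweRM ?poweR_ge0// ?poweRK//.
by apply: integral_ge0 => x _; exact: poweR_ge0.
Qed.

(** Monotone convergence along increasing sets, in the form that later gives one-sided continuity of
    the weight norms in the endpoint. *)
Lemma normp_bigcup_le (F : (set T)^nat) f (b : \bar R) :
  nondecreasing_seq F -> (forall i, measurable (F i)) ->
  (forall i, measurable_fun (F i) f) ->
  (forall i, normp mu p%:E (F i) f <= b) ->
  normp mu p%:E (\bigcup_i F i) f <= b.
Proof.
move=> ndF mF mf Fb.
have b0 : 0 <= b by apply: le_trans (Fb 0%N); exact: normp_ge0.
rewrite -(poweRK pn0 b0) normpE ge0_le_poweR ?invr_ge0 ?(ltW p0)//.
  by apply: integral_ge0 => x _; exact: poweR_ge0.
have mfp i : measurable_fun (F i) (fun x => `|f x| `^ p).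
  exact: measurable_poweR_abse.
have fp0 i x : F i x -> 0 <= `|f x| `^ p by move=> _; exact: poweR_ge0.
have /cvg_lim <- // :=
  @ge0_nondecreasing_set_cvg_integral _ _ _ _ _ mu ndF mF mfp fp0.
apply: lime_le.
  apply: ereal_nondecreasing_is_cvgn.
  exact: ge0_nondecreasing_set_nondecreasing_integral.
apply: nearW => i; rewrite -poweR_normp ge0_le_poweR ?(ltW p0)//.
exact: normp_ge0.
Qed.

Lemma normp_setD_null A N f : measurable A -> measurable N ->
  measurable_fun A f -> mu N = 0 ->
  normp mu p%:E A f = normp mu p%:E (A `\` N) f.
Proof.
move=> mA mN mf N0; rewrite !normpE; congr (_ `^ _).
apply: ge0_negligible_integral => // [|x _]; last exact: poweR_ge0.
apply: (@measurableT_comp _ _ _ _ _ _ (fun x => x `^ p)) => //.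
  exact: measurable_poweR.
exact: measurableT_comp.
Qed.

Lemma normp_indic A D : measurable A -> measurable D ->
  normp mu p%:E A (EFin \o \1_D) = mu (D `&` A) `^ p^-1.
Proof.
move=> mA mD; rewrite normpE -integral_indic//; congr (_ `^ _).
apply: eq_integral => x _; rewrite /= indicE.
by case: (x \in D); rewrite ?normr1 ?normr0 ?powR1 ?powR0.
Qed.

End normp_theory.

(** * Minkowski's inequality over sections of a set, and its use for the two Morrey-type norms *)

Section minkowski_section.
Context d1 d2 {T1 : measurableType d1} {T2 : measurableType d2} {R : realType}.
Variable m1 : {sigma_finite_measure set T1 -> \bar R}.
Variable m2 : {sigma_finite_measure set T2 -> \bar R}.
Variable E : set (T1 * T2).
Hypothesis mE : measurable E.

(** The integral over a section is a partial integral of [1_E * h], so Tonelli applies. This later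
    makes [W1] and [W2] measurable as functions of |x|. *)
Lemma measurable_integral_xsection (h : T2 -> \bar R) :
  measurable_fun setT h -> (forall y, 0 <= h y) ->
  measurable_fun setT (fun x => \int[m2]_(y in xsection E x) h y).
Proof.
move=> mh h0.
pose k (z : T1 * T2) := (\1_E z)%:E * h z.2.
have mk : measurable_fun setT k.
  apply: emeasurable_funM; last exact: measurableT_comp.
  by apply/measurable_EFinP; exact: measurable_indic.
have k0 z : 0 <= k z by rewrite mule_ge0// lee_fin.
have := measurable_fun_fubini_tonelli_F (m2 := m2) k mk k0.
congr measurable_fun; apply/funext => x; rewrite [RHS]integral_mkcond.
apply: eq_integral => y _; rewrite /k patchE indicE mem_xsection.
by case: ifPn => _; rewrite ?mul1e ?mul0e.
Qed.

(** Minkowski's inequality for the kernel [g x * 1_E(x, y) * h y]: the indicator turns the inner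
    integrals into integrals over sections, and the factor independent of the inner variable comes
    out. *)
Lemma minkowski_section (g : T1 -> \bar R) (h : T2 -> \bar R) (q : R) :
  measurable_fun setT g -> (forall x, 0 <= g x) ->
  measurable_fun setT h -> (forall y, 0 <= h y) -> (1 < q)%R ->
  (\int[m2]_y (h y * \int[m1]_(x in ysection E y) g x) `^ q) `^ q^-1
    <= \int[m1]_x (g x * (\int[m2]_(y in xsection E x) h y `^ q) `^ q^-1).
Proof.
move=> mg g0 mh h0 q1.
have q0 : (0 < q)%R by exact: lt_trans q1.
have qn0 : q != 0%R by rewrite gt_eqF.
pose k (z : T1 * T2) := g z.1 * (\1_E z)%:E * h z.2.
have mk : measurable_fun setT k.
  apply: emeasurable_funM; last exact: measurableT_comp.
  apply: emeasurable_funM; first exact: measurableT_comp.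
  by apply/measurable_EFinP; exact: measurable_indic.
have k0 z : 0 <= k z by rewrite !mule_ge0// lee_fin.
have := minkowski_integral m1 m2 mk k0 q1.
congr (_ `^ _ <= _).
  apply: eq_integral => y _; congr (_ `^ _).
  rewrite /k /= ge0_integralZr//; last 2 first.
  - apply: emeasurable_funM => //; apply/measurable_EFinP.
    by apply: measurableT_comp => //; exact: measurable_indic.
  - by move=> x _; rewrite mule_ge0// lee_fin.
  rewrite muleC; congr (_ * _); rewrite [RHS]integral_mkcond.
  apply: eq_integral => x _; rewrite patchE indicE mem_ysection.
  by case: ifPn => _; rewrite ?mule1 ?mule0.
apply: eq_integral => x _.
have mhq : measurable_fun setT (fun y => h y `^ q).
  exact: (measurableT_comp (measurable_poweR _)).
transitivity ((\int[m2]_y (g x `^ q * ((\1_E (x, y))%:E * h y `^ q))) `^ q^-1).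
  congr (_ `^ _); apply: eq_integral => y _; rewrite /k -muleA.
  rewrite poweRM ?mule_ge0// ?lee_fin//; congr (_ * _).
  rewrite poweRM// ?lee_fin// indicE.
  by case: (_ \in _) => /=; rewrite ?powR1 ?powR0.
rewrite ge0_integralZl//; last 3 first.
- apply: emeasurable_funM => //; apply/measurable_EFinP.
  by apply: measurableT_comp => //; exact: measurable_indic.
- by move=> y _; rewrite mule_ge0 ?poweR_ge0// lee_fin.
- exact: poweR_ge0.
rewrite poweRM ?poweR_ge0//; last first.
  by apply: integral_ge0 => y _; rewrite mule_ge0 ?poweR_ge0// lee_fin.
rewrite poweRK//; congr (_ * _ `^ _); rewrite [RHS]integral_mkcond.
apply: eq_integral => y _; rewrite patchE indicE mem_xsection.
by case: ifPn => _; rewrite ?mul1e ?mul0e.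
Qed.

End minkowski_section.

Section embedding_estimates.
Context {R : realType} {n : nat}.
Local Notation mu := (@lebesgue_Rn R n).
Local Notation nu := (@completed_lebesgue_measure R).
Local Notation norm := (@euclidean_norm R n).
Implicit Types (p theta : R) (omega : lebR R -> \bar R).
Implicit Types (v f : lebRn R n -> \bar R).

Let measurable_norm1 :
  measurable_fun setT (fun z : lebRn R n * lebR R => norm z.1).
Proof. exact: (measurableT_comp measurable_euclidean_norm). Qed.

Let measurable_norm2 :
  measurable_fun setT (fun z : lebR R * lebRn R n => norm z.2).
Proof. exact: (measurableT_comp measurable_euclidean_norm). Qed.

Let measurable_id1 :
  measurable_fun setT (fun z : lebR R * lebRn R n => z.1 : R).
Proof. exact: (measurableT_comp measurable_lebR_id). Qed.

Let measurable_id2 :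
  measurable_fun setT (fun z : lebRn R n * lebR R => z.2 : R).
Proof. exact: (measurableT_comp measurable_lebR_id). Qed.

(** The set behind the first Minkowski estimate: fixing the radius gives a ball, fixing [x] gives
    the half-line beyond |x|. *)
Lemma measurable_norm_lt :
  measurable [set z : lebRn R n * lebR R | (norm z.1 < z.2)%R].
Proof.
rewrite -[X in measurable X]setTI.
exact: (measurable_fun_ltr measurable_norm1 measurable_id2).
Qed.

(** The set behind the second estimate: fixing the radius gives the exterior of a ball, fixing [x]
    gives the radii below |x|. *)
Lemma measurable_lt_norm :
  measurable [set z : lebR R * lebRn R n | (z.1 < norm z.2)%R].
Proof.
rewrite -[X in measurable X]setTI.
exact: (measurable_fun_ltr measurable_id1 measurable_norm2).
Qed.

Lemma xsection_norm_lt (x : lebRn R n) :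
  xsection [set z : lebRn R n * lebR R | (norm z.1 < z.2)%R] x
    = itvR `]norm x, +oo[.
Proof.
by apply/seteqP; split => t; rewrite itvRE in_itv/= andbT /xsection/= inE.
Qed.

Lemma ysection_lt_norm (x : lebRn R n) :
  ysection [set z : lebR R * lebRn R n | (z.1 < norm z.2)%R] x
    = itvR `]-oo, norm x[.
Proof. by apply/seteqP; split => t; rewrite itvRE in_itv/= /ysection/= inE. Qed.

(* Minkowski's inequality with [|f v|^p] on R^n and [omega^p] on (0, oo). *)
Lemma LM_norm_le p theta omega v f : (0 < p)%R -> (p < theta)%R ->
  measurable_fun (itvR `]0%R, +oo[) omega ->
  measurable_fun setT v -> measurable_fun setT f ->
  LM_norm p%:E theta%:E omega v f `^ p <=
  \int[mu]_x
    (`|f x * v x| * normp nu theta%:E (itvR `]norm x, +oo[) omega) `^ p.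
Proof.
move=> p0 ptheta momega mv mf.
have theta0 : (0 < theta)%R by exact: lt_trans ptheta.
have pn0 : p != 0%R by rewrite gt_eqF.
have thetan0 : theta != 0%R by rewrite gt_eqF.
(* The [p]-th power of an L^theta norm is the L^q norm of a [p]-th power, and [q > 1] because
   [p < theta]. *)
pose q := (theta / p)%R.
have q1 : (1 < q)%R by rewrite ltr_pdivlMr// mul1r.
have pq : (p * q = theta)%R by rewrite /q mulrCA divff ?mulr1.
have qV : (theta^-1 * p = q^-1)%R by rewrite /q invf_div mulrC.
pose g x := `|f x * v x| `^ p.
pose h t := `|(omega \_ (itvR `]0%R, +oo[)) t| `^ p.
have := @minkowski_section _ _ _ _ _ mu nu _ measurable_norm_lt g h q.
move=> /(_ _ _ _ _ q1) M; apply: (le_trans _ (le_trans (M _ _ _ _) _)).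
- rewrite /LM_norm /wnormp (normpE _ theta0) -poweRrM qV.
  rewrite [X in X `^ _ <= _]integral_mkcond.
  rewrite le_eqVlt; apply/orP; left; apply/eqP; congr (_ `^ _).
  apply: eq_integral => t _; rewrite /h !patchE; case: ifPn => _; last first.
    by rewrite abse0 poweR0r// mul0e poweR0r// gt_eqF// (lt_trans _ q1).
  rewrite -pq poweRrM; congr (_ `^ _).
  rewrite abseM poweRM// muleC; congr (_ * _).
  rewrite gee0_abs ?normp_ge0// (normpE _ p0) poweRVK//; last first.
    by apply: integral_ge0 => x _; exact: poweR_ge0.
  congr (integral _ _ _).
  by apply/seteqP; split => x /=; rewrite /ysection/= inE.
- by apply: measurable_poweR_abse; exact: emeasurable_funM.
- by move=> x; exact: poweR_ge0.
- by apply: measurable_poweR_abse; exact: measurable_restrict_pos.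
- by move=> x; exact: poweR_ge0.
- rewrite le_eqVlt; apply/orP; left; apply/eqP; apply: eq_integral => x _.
  rewrite poweRM ?normp_ge0//; congr (_ * _).
  rewrite (normpE _ theta0) -poweRrM qV; congr (_ `^ _).
  rewrite [RHS]integral_mkcond [LHS]integral_mkcond.
  apply: eq_integral => t _; rewrite /h !patchE.
  rewrite xsection_norm_lt; case: ifPn => //.
  rewrite mem_itvR !in_itv/= andbT => xt.
  rewrite ifT; last first.
    by rewrite mem_itvR in_itv/= andbT (le_lt_trans (euclidean_norm_ge0 _) xt).
  by rewrite -poweRrM pq.
Qed.

(* Minkowski's inequality the other way round, with [omega^theta] on (0, oo) and
   [|f v|^theta] on R^n. *)
Lemma cLM_norm_ge p theta omega v f : (0 < theta)%R -> (theta < p)%R ->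
  measurable_fun (itvR `]0%R, +oo[) omega ->
  measurable_fun setT v -> measurable_fun setT f ->
  \int[mu]_x (`|f x * v x| * normp nu theta%:E (itvR `]0%R, norm x[) omega) `^ p
    <= cLM_norm p%:E theta%:E omega v f `^ p.
Proof.
move=> theta0 thetap momega mv mf.
have p0 : (0 < p)%R by exact: lt_trans thetap.
have pn0 : p != 0%R by rewrite gt_eqF.
have thetan0 : theta != 0%R by rewrite gt_eqF.
(* Here the inner integral is that of [omega ^ theta], and [theta < p] puts the exponent above 1. *)
pose q := (p / theta)%R.
have q1 : (1 < q)%R by rewrite ltr_pdivlMr// mul1r.
have q0 : (0 < q)%R by exact: lt_trans q1.
have pq : (theta * q = p)%R by rewrite /q mulrCA divff ?mulr1.
have qV : (p^-1 * theta = q^-1)%R by rewrite /q invf_div mulrC.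
pose g s := `|(omega \_ (itvR `]0%R, +oo[)) s| `^ theta.
pose h x := `|f x * v x| `^ theta.
have := @minkowski_section _ _ _ _ _ nu mu _ measurable_lt_norm g h q.
move=> /(_ _ _ _ _ q1) M.
set I := \int[mu]_x _.
have I0 : 0 <= I by apply: integral_ge0 => x _; exact: poweR_ge0.
suff : I `^ q^-1 <= cLM_norm p%:E theta%:E omega v f `^ theta.
  move=> /(ge0_le_poweR (ltW q0) (poweR_ge0 _ _)).
  by rewrite poweRVK ?gt_eqF// -poweRrM pq.
apply: (le_trans _ (le_trans (M _ _ _ _) _)).
- rewrite le_eqVlt; apply/orP; left; apply/eqP; congr (_ `^ _).
  apply: eq_integral => x _; rewrite -pq poweRrM; congr (_ `^ _).
  rewrite poweRM ?normp_ge0//; congr (_ * _); rewrite (poweR_normp _ theta0).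
  rewrite [RHS]integral_mkcond [LHS]integral_mkcond.
  apply: eq_integral => t _; rewrite /g !patchE.
  rewrite ysection_lt_norm !mem_itvR !in_itv/= andbT.
  by case: (0 < t)%R => //; case: ifPn => // _; rewrite abse0 poweR0r.
- by apply: measurable_poweR_abse; exact: measurable_restrict_pos.
- by move=> x; exact: poweR_ge0.
- by apply: measurable_poweR_abse; exact: emeasurable_funM.
- by move=> x; exact: poweR_ge0.
- rewrite /cLM_norm /wnormp (poweR_normp _ theta0) [leRHS]integral_mkcond.
  apply: ge0_le_integral_nomeas => s _.
    by rewrite mule_ge0 ?poweR_ge0.
  rewrite /g !patchE; case: ifPn => sp; last by rewrite abse0 poweR0r// mul0e.
  rewrite abseM poweRM// muleC lee_wpmul2r ?poweR_ge0//.
  rewrite gee0_abs ?normp_ge0// (normpE _ p0) -[leRHS]poweRrM qV.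
  rewrite ge0_le_poweR ?invr_ge0 ?(ltW q0)//.
    by apply: integral_ge0 => x _; exact: poweR_ge0.
  (* The section is |x| > s, while the norm is over the complement of the open ball, sphere
     included; inclusion gives the needed direction. *)
  rewrite [leLHS]integral_mkcond [leRHS]integral_mkcond.
  apply: ge0_le_integral_nomeas => x _.
    by apply: erestrict_ge0 => *; exact: poweR_ge0.
  rewrite !patchE; case: ifPn => [|_]; last first.
    by case: ifPn => // _; exact: poweR_ge0.
  rewrite inE /xsection/= inE/= => sx.
  by rewrite ifT ?inE/= /h -?poweRrM ?pq//; apply/negP; rewrite -leNgt ltW.
Qed.

End embedding_estimates.

Lemma ae_forall_countable d (T : measurableType d) (R : realType)
    (mu : {measure set T -> \bar R}) (I : countType) (P : I -> T -> Prop) :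
  (forall i, {ae mu, forall x, P i x}) -> {ae mu, forall x, forall i, P i x}.
Proof.
move=> aeP.
have : {ae mu, forall x, forall k, oapp (P ^~ x) True (unpickle k)}.
  apply: ae_foralln => k.
  by case: (unpickle k) => [i|]; [exact: aeP|exact: nearW].
by apply: filterS => x Px i; have := Px (pickle i); rewrite pickleK.
Qed.

(** * One-sided continuity of the weight norms in the endpoint *)

Section norms_on_half_lines.
Context {R : realType}.
Local Notation nu := (@completed_lebesgue_measure R).
Variables (theta : R) (omega : lebR R -> \bar R).
Hypothesis theta0 : (0 < theta)%R.
Hypothesis momega : measurable_fun (itvR `]0%R, +oo[) omega.

Let momegaS (i : interval R) : {subset i <= `]0%R, +oo[} ->
  measurable_fun (itvR i) omega.
Proof.
move=> i0; apply: measurable_funS momega => //; first exact: measurable_itvR.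
Qed.

(** Right-continuity in the lower endpoint: (r, oo) is the increasing union of the half-lines (r +
    1/(k+1), oo). *)
Lemma normp_oy_le (r : R) (b : \bar R) : (0 <= r)%R ->
  (forall t, (r < t)%R -> normp nu theta%:E (itvR `]t, +oo[) omega <= b) ->
  normp nu theta%:E (itvR `]r, +oo[) omega <= b.
Proof.
move=> r0 rb; pose F k := @itvR R `](r + k.+1%:R^-1)%R, +oo[.
have -> : itvR `]r, +oo[ = \bigcup_k F k.
  apply/seteqP; split => t.
    rewrite itvRE in_itv/= andbT => /ltr_add_invr[k rk].
    by exists k => //; rewrite /F itvRE in_itv/= rk.
  move=> [k _]; rewrite /F !itvRE !in_itv/= !andbT; apply: lt_trans.
  by rewrite ltrDl invr_gt0.
apply: normp_bigcup_le => //.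
- move=> k l kl; apply/subsetPset => t; rewrite /F !itvRE !in_itv/= !andbT.
  by apply: le_lt_trans; rewrite lerD2l lef_pV2 ?posrE// ler_nat ltnS.
- by move=> k; exact: measurable_itvR.
- move=> k; apply: momegaS => t; rewrite !in_itv/= !andbT; apply: le_lt_trans.
  by rewrite addr_ge0.
- by move=> k; apply: rb; rewrite ltrDl invr_gt0.
Qed.

(** Left-continuity in the upper endpoint, by exhausting (0, r) with the intervals (0, r -
    1/(k+1)). *)
Lemma normp_0o_le (r : R) (b : \bar R) :
  (forall s, (s < r)%R -> normp nu theta%:E (itvR `]0%R, s[) omega <= b) ->
  normp nu theta%:E (itvR `]0%R, r[) omega <= b.
Proof.
move=> rb; pose F k := @itvR R `]0%R, (r - k.+1%:R^-1)%R[.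
have -> : itvR `]0%R, r[ = \bigcup_k F k.
  apply/seteqP; split => t.
    rewrite itvRE in_itv/= => /andP[t0 /ltr_add_invr[k rk]].
    by exists k => //; rewrite /F itvRE in_itv/= t0 ltrBrDr.
  move=> [k _]; rewrite /F !itvRE !in_itv/= => /andP[-> /=] /lt_trans; apply.
  by rewrite gtrBl invr_gt0.
apply: normp_bigcup_le => //.
- move=> k l kl; apply/subsetPset => t; rewrite /F !itvRE !in_itv/=.
  move=> /andP[-> /=] /lt_le_trans; apply.
  by rewrite lerD2l lerN2 lef_pV2 ?posrE// ler_nat ltnS.
- by move=> k; exact: measurable_itvR.
- by move=> k; apply: momegaS => t; rewrite !in_itv/= andbT => /andP[].
- by move=> k; apply: rb; rewrite gtrBl invr_gt0.
Qed.

Lemma normp_0c (r : R) :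
  normp nu theta%:E (itvR `]0%R, r]) omega
    = normp nu theta%:E (itvR `]0%R, r[) omega.
Proof.
rewrite (@normp_setD_null _ _ _ _ _ theta0 _ [set r : lebR R]).
- congr normp; apply/seteqP; split => t; rewrite /setD/= !itvRE !in_itv/=.
    by move=> [/andP[-> tr] /eqP]; rewrite lt_neqAle tr andbT.
  by move=> /andP[-> tr]; split; [exact: ltW|move=> tE; rewrite tE ltxx in tr].
- exact: measurable_itvR.
- by apply: sub_caratheodory; exact: measurable_set1.
- by apply: momegaS => t; rewrite !in_itv/= andbT => /andP[].
- exact: completed_lebesgue_measure_set1.
Qed.

Lemma normp_0o_le0 (r : R) : (r <= 0)%R ->
  normp nu theta%:E (itvR `]0%R, r[) omega = 0.
Proof.
move=> r0; rewrite (_ : itvR _ = set0).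
  by rewrite normpE// integral_set0 poweR0r// invr_eq0 gt_eqF.
apply/seteqP; split => t //; rewrite itvRE in_itv/= => /andP[t0 tr].
by have := lt_trans t0 tr; rewrite ltNge r0.
Qed.

End norms_on_half_lines.

Section measurable_normp_xsection.
Context d1 d2 {T1 : measurableType d1} {T2 : measurableType d2} {R : realType}.
Variable m2 : {sigma_finite_measure set T2 -> \bar R}.

Lemma measurable_normp_xsection (E : set (T1 * T2)) (p : R) (f : T2 -> \bar R) :
  measurable E -> (0 < p)%R -> measurable_fun setT f ->
  measurable_fun setT (fun x => normp m2 p%:E (xsection E x) f).
Proof.
move=> mE p0 mf; under eq_fun do rewrite normpE//.
apply: (measurableT_comp (measurable_poweR _)).
apply: measurable_integral_xsection => // [|y]; last exact: poweR_ge0.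
apply: (measurableT_comp (measurable_poweR _)); exact: measurableT_comp.
Qed.

End measurable_normp_xsection.

(** * Pointwise form of the supremum and the upper bound *)

Section embedding.
Context {R : realType} {n : nat}.
Local Notation mu := (@lebesgue_Rn R n).
Local Notation nu := (@completed_lebesgue_measure R).
Local Notation norm := (@euclidean_norm R n).
Variables (theta1 p theta2 : R).
Hypotheses (theta1_gt0 : (0 < theta1)%R) (theta1_lt_p : (theta1 < p)%R)
  (p_lt_theta2 : (p < theta2)%R).
Variables (v1 v2 : 'rV[R]_n.+1 -> R) (omega1 omega2 : lebR R -> \bar R).
Hypotheses (wv1 : weight mu setT (EFin \o v1))
  (wv2 : weight mu setT (EFin \o v2))
  (Omega1 : cOmega theta1%:E omega1) (Omega2 : Omega theta2%:E omega2).

Let W1 (r : R) := normp nu theta1%:E (itvR `]0%R, r[) omega1.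
Let W2 (r : R) := normp nu theta2%:E (itvR `]r, +oo[) omega2.

Let p0 : (0 < p)%R. Proof. exact: lt_trans theta1_lt_p. Qed.
Let theta20 : (0 < theta2)%R. Proof. exact: lt_trans p_lt_theta2. Qed.
Local Lemma mo1 : measurable_fun (itvR `]0%R, +oo[) omega1.
Proof. exact: Omega1.1.1. Qed.
Local Lemma mo2 : measurable_fun (itvR `]0%R, +oo[) omega2.
Proof. exact: Omega2.1.1. Qed.
Local Lemma mv1 : measurable_fun setT (EFin \o v1 : lebRn R n -> \bar R).
Proof. exact: wv1.1. Qed.
Local Lemma mv2 : measurable_fun setT (EFin \o v2 : lebRn R n -> \bar R).
Proof. exact: wv2.1. Qed.

Let W1_fin (r : R) : W1 r \is a fin_num.
Proof.
have [r0|r0] := ltP 0%R r; last by rewrite /W1 normp_0o_le0.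
have /andP[W10 W1oo] := Omega1.2 r r0.
by rewrite ge0_fin_numE ?normp_ge0.
Qed.

Let W2_fin (r : R) : (0 < r)%R -> W2 r \is a fin_num /\ 0 < W2 r.
Proof.
move=> r0; have /andP[W20 W2oo] := Omega2.2 r r0.
by rewrite ge0_fin_numE ?normp_ge0.
Qed.

Let W1_ge0 (r : R) : 0 <= W1 r. Proof. exact: normp_ge0. Qed.
Let W2_ge0 (r : R) : 0 <= W2 r. Proof. exact: normp_ge0. Qed.

Let W2_le (r s : R) : (r <= s)%R -> W2 s <= W2 r.
Proof.
move=> rs; apply: normp_subset => // t; rewrite !itvRE !in_itv/= !andbT.
exact: le_lt_trans.
Qed.

Let W1_le (r s : R) : (r <= s)%R -> W1 r <= W1 s.
Proof.
move=> rs; apply: normp_subset => // t; rewrite !itvRE !in_itv/=.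
by move=> /andP[-> /lt_le_trans]; exact.
Qed.

Local Lemma measurable_W1 :
  measurable_fun setT (fun x : lebRn R n => W1 (norm x)).
Proof.
pose E := [set z : lebRn R n * lebR R | (z.2 < norm z.1)%R].
have mE : measurable E.
  have m1 : measurable_fun setT (fun z : lebRn R n * lebR R => z.2 : R).
    exact: (measurableT_comp measurable_lebR_id).
  have m2 : measurable_fun setT (fun z : lebRn R n * lebR R => norm z.1).
    exact: (measurableT_comp measurable_euclidean_norm).
  by rewrite -[X in measurable X]setTI; exact: (measurable_fun_ltr m1 m2).
have := @measurable_normp_xsection _ _ _ _ _ nu E _ _ mE theta1_gt0
  (measurable_restrict_pos mo1).
congr (measurable_fun _ _); apply/funext => x.
rewrite normp_restrict; congr normp.
apply/seteqP; split => t.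
  rewrite /setI/= !itvRE !in_itv/= andbT /xsection/= inE.
  by move=> [? ->].
by rewrite /setI/= !itvRE !in_itv/= andbT /xsection/= inE => /andP[].
Qed.

Local Lemma measurable_W2 :
  measurable_fun setT (fun x : lebRn R n => W2 (norm x)).
Proof.
have := @measurable_normp_xsection _ _ _ _ _ nu _ _ _ (@measurable_norm_lt R n)
  theta20 (measurable_restrict_pos mo2).
congr (measurable_fun _ _); apply/funext => x.
rewrite xsection_norm_lt normp_restrict.
congr normp; apply/seteqP; split => t; rewrite /setI/= !itvRE !in_itv/= !andbT.
  by case.
move=> xt; rewrite xt; split => //.
exact: le_lt_trans (euclidean_norm_ge0 _) xt.
Qed.

Let sup_term (t : R) :=
  wnormp mu +oo (fun x => (v1 x)%:E^-1 * (v2 x)%:E) (eball t)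
    (fun x => (W1 (norm x))^-1) * W2 t.

(* At a point with W1(|x|) = 0, such as the origin, the left-hand side has the
   inverse 0^-1 = +oo, so both sides fail where [v1] and [v2] are positive; this
   is why the origin need not be treated separately. *)
Let ae_sup_term (t C : R) : (0 < t)%R -> (0 <= C)%R -> sup_term t <= C%:E <->
  {ae mu, forall x, eball t x ->
    (v2 x)%:E * W2 t <= (C * v1 x)%:E * W1 (norm x)}.
Proof.
move=> t0 C0; have [W2fin W20] := W2_fin t0.
pose s := fine (W2 t); have W2E : W2 t = s%:E by rewrite fineK.
have s0 : (0 < s)%R by rewrite -lte_fin -W2E.
pose F x := (W1 (norm x))^-1 * ((v1 x)%:E^-1 * (v2 x)%:E).
have FE x : (0 < v1 x)%R -> (0 < v2 x)%R ->
    (`|F x| <= (C / s)%:E) = ((v2 x)%:E * W2 t <= (C * v1 x)%:E * W1 (norm x)).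
  move=> v10 v20; rewrite W2E /F -(fineK (W1_fin _)).
  set w := fine _; have w0 : (0 <= w)%R by apply: fine_ge0.
  rewrite (inver (v1 x)) gt_eqF// -!EFinM.
  move: w0; rewrite le_eqVlt => /predU1P[<-|w0].
    rewrite inve0 gt0_mulye ?lte_fin ?mulr_gt0 ?invr_gt0//= mulr0.
    by rewrite [RHS]lee_fin [RHS]leNgt mulr_gt0.
  rewrite inver gt_eqF// -!EFinM lee_fin [RHS]lee_fin.
  rewrite ger0_norm ?mulr_ge0 ?invr_ge0 ?(ltW v10) ?(ltW v20) ?(ltW w0)//.
  rewrite ler_pdivlMr//.
  have -> : (w^-1 * ((v1 x)^-1 * v2 x) * s = v2 x * s / (v1 x * w))%R.
    by field; rewrite !gt_eqF.
  by rewrite ler_pdivrMr ?mulr_gt0// mulrA.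
rewrite /sup_term W2E muleC -lee_pdivlMl// -EFinM [(_ * C)%R]mulrC.
(* The norm with exponent [+oo] is the essential supremum if the whole space has positive measure
   and [0] otherwise; in the second case every property holds almost everywhere. *)
rewrite /wnormp /normp unlock; case: ifPn => [muT|]; last first.
  rewrite -leNgt => muT; split=> [_|_]; last by rewrite lee_fin divr_ge0// ltW.
  by apply: (@negligibleS _ _ _ _ setT) => //; apply/negligibleP => //;
    apply/eqP; rewrite eq_le muT/=.
have aeE : {ae mu, forall x, (`|(F \_ (eball t)) x| <= (C / s)%:E) =
    ((x \in eball t) ==> ((v2 x)%:E * W2 t <= (C * v1 x)%:E * W1 (norm x)))}.
  apply: filterS2 wv1.2 wv2.2 => x /(_ I)/= /andP[v10 _] /(_ I)/= /andP[v20 _].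
  rewrite patchE; case: ifPn => _ /=; first by rewrite FE.
  by rewrite normr0 lee_fin divr_ge0// ltW.
split => [/ess_supP h|h].
  apply: filterS2 h aeE => x/= -> /esym/implyP xE xt; rewrite -W2E.
  by apply: xE => //; exact/mem_set.
apply/ess_supP; apply: filterS2 h aeE => x/= xE ->.
by apply/implyP => /set_mem xt; rewrite W2E; exact: xE.
Qed.

(** Almost every [x] satisfies the bounds for all rational radii [t > |x|] at once; letting [t]
    decrease to |x| replaces [W2 t] by [W2 (norm x)]. *)
Let sup_term_weight (C : R) : (0 <= C)%R ->
  (forall t, (0 < t)%R -> sup_term t <= C%:E) ->
  {ae mu, forall x, (v2 x)%:E * W2 (norm x) <= (C * v1 x)%:E * W1 (norm x)}.
Proof.
move=> C0 supC.
have : {ae mu, forall x, forall q : rat,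
    (0 < ratr q :> R)%R -> eball (ratr q) x ->
    (v2 x)%:E * W2 (ratr q) <= (C * v1 x)%:E * W1 (norm x)}.
  apply: ae_forall_countable => q.
  have [q0|q0] := ltP 0%R (ratr q : R); last by apply: nearW.
  have := (ae_sup_term q0 C0).1 (supC _ q0).
  by apply: filterS => x + _; exact.
apply: filterS3 wv1.2 wv2.2 => x /(_ I)/= /andP[v10 _] /(_ I)/= /andP[v20 _] xq.
rewrite !lte_fin in v10 v20.
(* With [v2 x] factored out of the right-hand side, what remains is a bound on [W2] alone, to which
   right-continuity applies. *)
have WE : (C * v1 x)%:E * W1 (norm x) =
    (v2 x)%:E * ((C * v1 x * fine (W1 (norm x))) / v2 x)%:E.
  by rewrite -[in LHS](fineK (W1_fin _)) -!EFinM mulrCA divff ?mulr1 ?gt_eqF.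
rewrite WE lee_wpmul2l ?lee_fin ?(ltW v20)//.
apply: (normp_oy_le theta20 mo2) => [|t xt]; first exact: euclidean_norm_ge0.
have [q /[!in_itv]/= /andP[xq' qt]] := rat_in_itvoo xt.
apply: (le_trans (W2_le (ltW qt))).
rewrite -(@lee_pmul2l _ (v2 x)%:E) ?lte_fin// -WE; apply: xq => //.
exact: le_lt_trans (euclidean_norm_ge0 _) xq'.
Qed.

(** After taking [p]-th powers, the two Minkowski estimates leave two integrals over R^n, whose
    integrands are compared almost everywhere by [sup_term_weight]. *)
Lemma LM_norm_le_cLM_norm (C : R) f : (0 <= C)%R ->
  (forall t, (0 < t)%R -> sup_term t <= C%:E) ->
  measurable_fun setT f ->
  LM_norm p%:E theta2%:E omega2 (EFin \o v2) f
    <= C%:E * cLM_norm p%:E theta1%:E omega1 (EFin \o v1) f.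
Proof.
move=> C0 supC mf.
have pn0 : p != 0%R by rewrite gt_eqF.
suff : LM_norm p%:E theta2%:E omega2 (EFin \o v2) f `^ p <=
    (C%:E * cLM_norm p%:E theta1%:E omega1 (EFin \o v1) f) `^ p.
  have pV0 : (0 <= p^-1)%R by rewrite invr_ge0 ltW.
  move/(ge0_le_poweR pV0 (poweR_ge0 _ _)); rewrite !poweRK//.
    by rewrite mule_ge0 ?lee_fin//; exact: normp_ge0.
  exact: normp_ge0.
apply: (le_trans (LM_norm_le p0 p_lt_theta2 mo2 mv2 mf)).
rewrite poweRM ?lee_fin//; last exact: normp_ge0.
apply: (le_trans _ (lee_wpmul2l (poweR_ge0 _ _)
  (cLM_norm_ge theta1_gt0 theta1_lt_p mo1 mv1 mf))).
have mpow (v W : lebRn R n -> \bar R) :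
    measurable_fun setT v -> measurable_fun setT W ->
    measurable_fun setT (fun x => (`|f x * v x| * W x) `^ p).
  move=> mv mW; apply: (measurableT_comp (measurable_poweR _)).
  apply: emeasurable_funM mW.
  apply: measurableT_comp; first exact: abse_measurable.
  exact: emeasurable_funM.
have mw1 := mpow _ _ mv1 measurable_W1; have mw2 := mpow _ _ mv2 measurable_W2.
have w0 (v W : lebRn R n -> \bar R) x : [set: lebRn R n] x ->
  0 <= (`|f x * v x| * W x) `^ p by move=> _; exact: poweR_ge0.
rewrite -(@ge0_integralZl _ _ _ mu _ measurableT _ mw1 _ (w0 _ _)
  (poweR_ge0 _ _)).
apply: (@ae_ge0_le_integral _ _ _ mu _ measurableT _ _ (w0 _ _) mw2).
- by move=> x _; exact: mule_ge0 (poweR_ge0 _ _) (poweR_ge0 _ _).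
- by apply: emeasurable_funM mw1; exact: measurable_cst.
apply: filterS3 wv1.2 wv2.2 (sup_term_weight C0 supC).
move=> x /(_ I)/= /andP[v10 _] /(_ I)/= /andP[v20 _] xW _.
rewrite -poweR_EFin -poweRM ?lee_fin ?mule_ge0//.
apply: ge0_le_poweR; [exact: ltW|by rewrite mule_ge0|].
rewrite !abseM (gee0_abs (ltW v10)) (gee0_abs (ltW v20)) -!muleA.
apply: (le_trans (lee_wpmul2l (abse_ge0 _) xW)).
by rewrite EFinM -muleA muleCA.
Qed.

(** Keep only the radii [s > t] in the outer norm; for these the ball of radius [s] contains that of
    radius [t]. *)
Let LM_norm_ge (t : R) f : (0 < t)%R ->
  wnormp mu p%:E (EFin \o v2) (eball t) f * W2 t
    <= LM_norm p%:E theta2%:E omega2 (EFin \o v2) f.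
Proof.
move=> t0; rewrite /W2 -normpZl//; last 3 first.
- exact: measurable_itvR.
- apply: measurable_funS mo2; first exact: measurable_itvR.
  by move=> s; rewrite !itvRE !in_itv/= !andbT; exact: lt_trans.
- exact: normp_ge0.
apply: (@le_trans _ _ (wnormp nu theta2%:E omega2 (itvR `]t, +oo[)
    (fun s => wnormp mu p%:E (EFin \o v2) (eball s) f))).
  apply: le_normp => // s; rewrite itvRE in_itv/= andbT => ts.
  rewrite !abseM lee_wpmul2r// !gee0_abs ?normp_ge0//.
  by apply: normp_subset => // x /lt_trans; exact.
apply: normp_subset => // s; rewrite !itvRE !in_itv/= !andbT.
exact: lt_trans.
Qed.

(** * Lower bound by test functions *)

Section test_functions.
Variables (a b c t : R).
Hypotheses (c0 : (0 <= c)%R) (ca : (c < a)%R) (b0 : (0 < b)%R) (t0 : (0 < t)%R).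
Hypothesis c_admissible : forall f,
  cLM p%:E theta1%:E omega1 (EFin \o v1) f ->
  LM_norm p%:E theta2%:E omega2 (EFin \o v2) f
    <= c%:E * cLM_norm p%:E theta1%:E omega1 (EFin \o v1) f.

(** At points of [D] the inequality [v2 W2(t) <= a v1 W1(|x|)] fails, with [b] separating the two
    sides after division by [a v1]. *)
Let D : set (lebRn R n) := [set x | [/\ eball t x, (0 < v1 x)%R,
  W1 (norm x) < b%:E & (a * b * v1 x)%:E < (v2 x)%:E * W2 t]].

Local Lemma mD : measurable D.
Proof.
rewrite (_ : D =
    eball t `&` ([set: lebRn R n] `&` [set x | 0 < (EFin \o v1) x]) `&`
    ([set: lebRn R n] `&` [set x | W1 (norm x) < b%:E]) `&`
    ([set: lebRn R n] `&`
     [set x | 0 < (v2 x)%:E * W2 t - (a * b * v1 x)%:E])); last first.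
  apply/seteqP; split => x.
    move=> [xt v1x xb]; rewrite -sube_gt0 => xD.
    exact: (conj (conj (conj xt (conj I v1x)) (conj I xb)) (conj I xD)).
  by move=> [[[xt [_ v1x]] [_ xb]] [_]]; rewrite /mkset sube_gt0.
apply: measurableI; [apply: measurableI; [apply: measurableI|]|].
- exact: measurable_eball.
- exact: (emeasurable_fun_o_infty measurableT mv1).
- exact: (emeasurable_fun_infty_o measurableT measurable_W1).
- apply: (emeasurable_fun_o_infty measurableT); apply: emeasurable_funB.
    by apply: emeasurable_funM mv2 _; exact: measurable_cst.
  under eq_fun do rewrite EFinM.
  by apply: emeasurable_funM mv1; exact: measurable_cst.
Qed.

Let m := mu D `^ p^-1.

Let m_ge0 : 0 <= m. Proof. exact: poweR_ge0. Qed.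

Let m_lty : m < +oo.
Proof.
apply: poweR_lty; apply: le_lt_trans (lebesgue_Rn_eball_lty t).
apply: le_measure; rewrite ?inE; [exact: mD|exact: measurable_eball|].
by move=> x [].
Qed.

(* [powR] is used for the inverse because it is known to be measurable. *)
Let f (x : lebRn R n) : \bar R := (\1_D x * v1 x `^ (-1))%:E.

Let fE x : D x -> f x = (v1 x)^-1%:E.
Proof.
by move=> Dx; rewrite /f indicE mem_set// mul1r powR_inv1//; case: Dx => _ /ltW.
Qed.

Let fNE x : ~ D x -> f x = 0.
Proof. by move=> Dx; rewrite /f indicE memNset// mul0r. Qed.

Let fv1 x : f x * (v1 x)%:E = (\1_D x)%:E.
Proof.
rewrite indicE; case: (boolP (x \in D)) => [/set_mem Dx|/negP Dx].
  by rewrite fE// -EFinM mulVf// gt_eqF//; case: Dx.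
by rewrite fNE ?mul0e// => /mem_set.
Qed.

Local Lemma mf : measurable_fun setT f.
Proof.
apply/measurable_EFinP; apply: measurable_funM.
  exact: (measurable_indic mD).
apply: (@measurableT_comp _ _ _ _ _ _ (@powR R ^~ (-1))%R).
  exact: measurable_powR.
exact: ((measurable_EFinP _ _).1 mv1).
Qed.

Local Lemma normp_fv1 A : measurable A ->
  wnormp mu p%:E (EFin \o v1) A f = mu (D `&` A) `^ p^-1.
Proof.
move=> mA; rewrite -(normp_indic _ p0 mA mD) /wnormp; congr normp.
by apply/funext => x; exact: fv1.
Qed.

(** On [D] the product [f v2 W2(t)] is [v2 W2(t) / v1], which exceeds [a b] by the last condition
    defining [D]; off [D] the indicator vanishes. *)
Local Lemma normp_fv2 :
  (a * b)%:E * m <= wnormp mu p%:E (EFin \o v2) (eball t) f * W2 t.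
Proof.
have [W2fin W20] := W2_fin t0.
have mt := @measurable_eball R n t.
have ab0 : (0 <= a * b)%R by rewrite mulr_ge0 ?(ltW b0)// (le_trans c0) ?ltW.
have -> : m = normp mu p%:E (eball t) (EFin \o \1_D).
  rewrite (normp_indic _ p0 mt mD) /m; congr (mu _ `^ _).
  by apply/esym/setIidl => x [].
rewrite -(normpZl _ p0 mt); last 2 first.
- apply/measurable_EFinP; apply: measurable_funS (measurable_indic mD) => //.
- by rewrite lee_fin.
rewrite [leRHS]muleC -(normpZl _ p0 mt); last 2 first.
- apply: measurable_funS (emeasurable_funM mf mv2) => //.
- exact: W2_ge0.
apply: (le_normp _ p0) => x _; rewrite /= indicE.
case: (boolP (x \in D)) => [/set_mem Dx|_]; last first.
  by rewrite mulr0 normr0; exact: abse_ge0.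
rewrite fE// mulr1 ger0_norm//.
have [_ v10 _] := Dx.
rewrite -(fineK W2fin) -!EFinM lte_fin => abv.
apply: le_trans (lee_abs _); rewrite lee_fin.
by rewrite mulrA mulrAC ler_pdivlMr// [leRHS]mulrC ltW.
Qed.

Let norms := [set norm x | x in D].

(** The inner norm never exceeds [m], the norm of [1_D], and vanishes once [s] exceeds the norms of
    all points of [D]; only the norm of [omega1] over a bounded interval remains. *)
Local Lemma cLM_norm_test : D !=set0 ->
  cLM_norm p%:E theta1%:E omega1 (EFin \o v1) f <= m * b%:E.
Proof.
move=> [x0 Dx0].
have has_sup_norms : has_sup norms.
  split; first by exists (norm x0); exists x0.
  by exists t => _ [x [xt _ _ _] <-]; exact: ltW.
(* [f] vanishes outside the closed ball of radius [r], and W1(r) <= b because W1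
   is left-continuous. *)
pose r := sup norms.
have W1r : normp nu theta1%:E (itvR `]0%R, r]) omega1 <= b%:E.
  (* The interval is closed at [r] because points of [D] may lie on the sphere of radius [r]; this
     endpoint is null. *)
  rewrite (normp_0c theta1_gt0 mo1).
  apply: (normp_0o_le theta1_gt0 mo1) => s sr.
  (* Below the supremum there is a point of [D] with larger norm, where [W1] is below [b] by
     definition of [D]. *)
  have [_ [x Dx <-] sx] := sup_gt has_sup_norms.1 sr.
  by apply: le_trans (W1_le (ltW sx)) _; apply: ltW; case: Dx.
apply: le_trans (lee_wpmul2l m_ge0 W1r).
rewrite -(normpZl _ theta1_gt0); last 3 first.
- exact: measurable_itvR.
- apply: measurable_funS mo1; first exact: measurable_itvR.
  by move=> s; rewrite !itvRE !in_itv/= andbT => /andP[].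
- exact: m_ge0.
rewrite /cLM_norm /wnormp [leRHS](_ : _ = normp nu theta1%:E (itvR `]0%R, +oo[)
    ((fun s => m * omega1 s) \_ (itvR `]0%R, r]))); last first.
  rewrite normp_restrict; congr normp; apply/seteqP; split => s.
    rewrite itvRE in_itv/= => /andP[s0 sr].
    by split; rewrite itvRE in_itv/= s0.
  by move=> [].
apply: (le_normp _ theta1_gt0) => s; rewrite itvRE in_itv/= andbT => s0.
rewrite patchE mem_itvR in_itv/= s0/=; case: ifPn => sr.
  rewrite !abseM lee_wpmul2r// !gee0_abs ?normp_ge0//.
  have mcs : measurable (~` (eball s : set (lebRn R n))).
    exact/measurableC/measurable_eball.
  have := normp_fv1 mcs; rewrite /wnormp => ->.
  apply: ge0_le_poweR; [by rewrite invr_ge0 ltW|exact: measure_ge0|].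
  apply: le_measure; rewrite ?inE; [exact: measurableI mD mcs|exact: mD|].
  exact: subIsetl.
rewrite -ltNge in sr.
rewrite [X in X * _](_ : _ = 0) ?mul0e//.
rewrite (normpE _ p0) integral0_eq ?poweR0r ?invr_eq0 ?gt_eqF// => x xs.
have Dx : ~ D x.
  move=> Dx; apply: xs; rewrite /eball/=; apply: le_lt_trans sr.
  by apply: ub_le_sup; [exact: has_sup_norms.2|exists x].
by rewrite fNE// mul0e abse0 poweR0r ?gt_eqF.
Qed.

(** Otherwise [m] is positive, and finite since [D] lies in a ball; cancelling [b m] in
    [a b m <= c m b] contradicts [c < a]. *)
Local Lemma D_null : mu D = 0.
Proof.
apply: contrapT => /eqP muD0.
have mfin : m \is a fin_num by rewrite ge0_fin_numE.
have m_gt0 : 0 < m by rewrite poweR_gt0// lt0e muD0/=.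
have D0 : D !=set0.
  by apply/set0P; apply: contra_neq muD0 => ->; rewrite measure0.
have Xf : cLM p%:E theta1%:E omega1 (EFin \o v1) f.
  split; first exact: mf.
  - move=> s s0; have mcs : measurable (~` (eball s : set (lebRn R n))).
      exact/measurableC/measurable_eball.
    rewrite normp_fv1//; apply: le_lt_trans m_lty.
    apply: ge0_le_poweR; [by rewrite invr_ge0 ltW|exact: measure_ge0|].
    apply: le_measure; rewrite ?inE; [exact: measurableI mD mcs|exact: mD|].
    exact: subIsetl.
  - apply: le_lt_trans (cLM_norm_test D0) _.
    exact: lte_mul_pinfty m_ge0 mfin (ltry _).
have cLMf := cLM_norm_test D0.
have : (a * b)%:E * m <= c%:E * (m * b%:E).
  apply: (le_trans normp_fv2); apply: (le_trans (LM_norm_ge f t0)).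
  apply: (le_trans (c_admissible Xf)).
  by apply: lee_wpmul2l; rewrite ?lee_fin.
rewrite -(fineK mfin) -!EFinM lee_fin mulrCA mulrC ler_pM2l ?fine_gt0 ?m_gt0//.
by rewrite ler_pM2r// leNgt ca.
Qed.

End test_functions.

(** The bound is proved with [c + e] for every [e > 0], because [D_null] needs a constant strictly
    above the admissible one. *)
Lemma sup_term_le (c t : R) : (0 <= c)%R -> (0 < t)%R ->
  (forall f, cLM p%:E theta1%:E omega1 (EFin \o v1) f ->
    LM_norm p%:E theta2%:E omega2 (EFin \o v2) f
      <= c%:E * cLM_norm p%:E theta1%:E omega1 (EFin \o v1) f) ->
  sup_term t <= c%:E.
Proof.
move=> c0 t0 cX; apply/lee_addgt0Pr => e e0; rewrite -EFinD.
set a := (c + e)%R.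
have ca : (c < a)%R by rewrite ltrDl.
have a0 : (0 < a)%R by exact: le_lt_trans ca.
apply/(ae_sup_term t0 (ltW a0)).
have [W2fin _] := W2_fin t0.
have : {ae mu, forall x, forall q : rat, (0 < ratr q :> R)%R ->
    ~ [/\ eball t x, (0 < v1 x)%R, W1 (norm x) < (ratr q)%:E &
       (a * ratr q * v1 x)%:E < (v2 x)%:E * W2 t]}.
  apply: ae_forall_countable => q.
  have [q0|q0] := ltP 0%R (ratr q : R); last exact: nearW.
  have := D_null c0 ca q0 t0 cX; have := mD a (ratr q) t.
  set D := (X in measurable X) => mD D0.
  by exists D; split => // x /= /not_implyP[_ /contrapT].
apply: filterS2 wv1.2 => x /(_ I)/= /andP[v10 _] xq xt.
rewrite lte_fin in v10.
rewrite leNgt; apply/negP.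
rewrite -(fineK (W1_fin _)) -(fineK W2fin) -!EFinM lte_fin.
set w := fine (W1 _); set s := fine (W2 _) => H.
have w_ge0 : (0 <= w)%R by exact: fine_ge0.
(* If the inequality fails at [x], a rational strictly between these two numbers serves as [b] and
   puts [x] in one of the null sets. *)
have wlt : (w < v2 x * s / (a * v1 x))%R.
  by rewrite ltr_pdivlMr ?mulr_gt0// mulrC.
have [q /[!in_itv]/= /andP[wq qs]] := rat_in_itvoo wlt.
apply: (xq q); first exact: le_lt_trans wq.
split => //; first by rewrite -(fineK (W1_fin _)) lte_fin.
rewrite -(fineK W2fin) -EFinM lte_fin.
by rewrite mulrAC mulrC -ltr_pdivlMr ?mulr_gt0.
Qed.

(** Local integrability follows from the finite [LM_norm]: as [W2 t > 0], [LM_norm_ge] makes the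
    norm over each ball finite, and every compact set lies in a ball. *)
Lemma cLM_sub_LM (C : R) f : (0 <= C)%R ->
  (forall t, (0 < t)%R -> sup_term t <= C%:E) ->
  cLM p%:E theta1%:E omega1 (EFin \o v1) f ->
  LM p%:E theta2%:E omega2 (EFin \o v2) f.
Proof.
move=> C0 supC [mf _ foo].
have LMoo : LM_norm p%:E theta2%:E omega2 (EFin \o v2) f < +oo.
  apply: le_lt_trans (LM_norm_le_cLM_norm C0 supC mf) _.
  by apply: lte_mul_pinfty; rewrite ?lee_fin.
split => // K /compact_sub_eball [t t0 Kt].
apply: (@le_lt_trans _ _ (wnormp mu p%:E (EFin \o v2) (eball t) f)).
  exact: (normp_subset _ p0).
have [W2fin W20] := W2_fin t0.
rewrite ltNge leye_eq; apply/negP => /eqP foo'.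
by have := le_lt_trans (LM_norm_ge f t0) LMoo; rewrite foo' gt0_mulye// ltxx.
Qed.

End embedding.

(** * Both bounds combined, with constant 1 *)

Theorem theorem2p11 (R : realType) (n : nat) (theta1 p theta2 : R)
    (theta1_gt0 : (0 < theta1)%R) (theta1_lt_p : (theta1 < p)%R)
    (p_lt_theta2 : (p < theta2)%R) :
  exists lam : R, (1 <= lam)%R /\
    forall (v1 v2 : 'rV[R]_n.+1 -> R) (omega1 omega2 : lebR R -> \bar R),
      weight (@lebesgue_Rn R n) setT (EFin \o v1) -> continuous v1 ->
      weight (@lebesgue_Rn R n) setT (EFin \o v2) -> continuous v2 ->
      cOmega theta1%:E omega1 -> Omega theta2%:E omega2 ->
      let I_norm :=
        embedding_norm
          (cLM p%:E theta1%:E omega1 (EFin \o v1))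
          (cLM_norm p%:E theta1%:E omega1 (EFin \o v1))
          (LM p%:E theta2%:E omega2 (EFin \o v2))
          (LM_norm p%:E theta2%:E omega2 (EFin \o v2)) in
      let rhs :=
        ereal_sup [set
          wnormp (@lebesgue_Rn R n) +oo (fun x => (v1 x)%:E^-1 * (v2 x)%:E)
            (eball t)
            (fun x => (normp completed_lebesgue_measure theta1%:E
                         (itvR `]0%R, euclidean_norm x[) omega1)^-1)
          * normp completed_lebesgue_measure theta2%:E (itvR `]t, +oo[) omega2
          | t in `]0%R, +oo[ ] in
      (lam^-1)%:E * rhs <= I_norm <= lam%:E * rhs.
Proof.
exists 1%R; split; first by [].
move=> v1 v2 omega1 omega2 wv1 _ wv2 _ O1 O2.
cbv zeta; set rhs := ereal_sup _.
rewrite invr1 !mul1e; apply/andP; split.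
  (* Every admissible constant bounds every term of the supremum. *)
  apply: le_ereal_inf_tmp => _ [c [c0 cX] <-].
  apply: ge_ereal_sup => _ [t + <-]; rewrite /= in_itv/= andbT => t0.
  apply: (sup_term_le theta1_gt0 theta1_lt_p p_lt_theta2) => // f Xf.
  exact: (cX f Xf).2.
have rhs0 : 0 <= rhs.
  apply: le_ereal_sup_tmp; eexists.
    by exists 1%R => //=; rewrite in_itv/= ltr01.
  by apply: mule_ge0; exact: Lnorm_ge0.
(* An infinite supremum leaves nothing to prove; a finite one is itself an admissible constant. *)
have [->|rhsoo] := eqVneq rhs +oo; first by rewrite leey.
have rhsfin : rhs \is a fin_num by rewrite ge0_fin_numE ?ltey.
rewrite -(fineK rhsfin); apply: ereal_inf_lbound; exists (fine rhs) => //.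
have C0 : (0 <= fine rhs)%R by exact: fine_ge0.
have supC t : (0 < t)%R ->
    wnormp (@lebesgue_Rn R n) +oo (fun x => (v1 x)%:E^-1 * (v2 x)%:E)
            (eball t)
            (fun x => (normp completed_lebesgue_measure theta1%:E
                         (itvR `]0%R, euclidean_norm x[) omega1)^-1)
    * normp completed_lebesgue_measure theta2%:E (itvR `]t, +oo[) omega2
    <= (fine rhs)%:E.
  move=> t0; rewrite fineK//; apply: ereal_sup_ubound; exists t => //=.
  by rewrite in_itv/= t0.
split=> // f Xf; split.
  exact: (cLM_sub_LM theta1_gt0 theta1_lt_p p_lt_theta2 wv1 wv2 O1 O2 C0 supC).
exact: (LM_norm_le_cLM_norm theta1_gt0 theta1_lt_p p_lt_theta2 wv1 wv2 O1 O2
  C0 supC (let: And3 mf _ _ := Xf in mf)).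
Qed.
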